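(* Let $p\in(1,2)$ and $v\in S_h(\Omega)$. Assume that every maximal polygonal region $S\subset\Omega$ with $|\nabla v|=0$ satisfies that $\partial S\cap\partial\Omega$ contains an element edge. Then there exists a positive constant $C^{\mathrm{PF}}_{p,v}$ such that $$\int_\Omega(|w|+|\nabla v|)^{p-2}|w|^2\,dx\le C^{\mathrm{PF}}_{p,v}\int_\Omega(|\nabla w|+|\nabla v|)^{p-2}|\nabla w|^2\,dx,\quad w\in W_0^{1,p}(\Omega).$$ Moreover, if $|\nabla v|$ does not vanish on $\Omega$, then $C^{\mathrm{PF}}_{p,v}$ has an upper bound $\overline{C}^{\mathrm{PF}}_{p,v}$ that is continuous at $v$ in $S_h(\Omega)$; that is, the constants $C^{\mathrm{PF}}_{p,v}$ can be chosen so that there is a real-valued function $v\mapsto\overline{C}^{\mathrm{PF}}_{p,v}$ on the set of all $v\in S_h(\Omega)$ with $|\nabla v|$ nonvanishing on $\Omega$, continuous at each such $v$, with $C^{\mathrm{PF}}_{p,v}\le\overline{C}^{\mathrm{PF}}_{p,v}$.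
   Context: $\Omega\subset\mathbb{R}^2$ is a bounded polygonal domain with Lipschitz boundary, $\mathcal{T}_h$ is a quasi-uniform triangulation of $\Omega$, and $S_h(\Omega)$ is the space of continuous piecewise linear functions on $\mathcal{T}_h$ vanishing on $\partial\Omega$. For $v\in S_h(\Omega)$, $|\nabla v|$ is piecewise constant on $\mathcal{T}_h$; ''$|\nabla v|$ does not vanish on $\Omega$'' means it is nonzero on every element. A maximal polygonal region with $|\nabla v|=0$ is an (open connected) polygonal region, the interior of a union of closed elements of $\mathcal{T}_h$ on each of which $|\nabla v|=0$, that is maximal with respect to inclusion. Integrands of the form $(|a|+|b|)^{p-2}|a|^2$ are read as $0$ where $a=0$ and $b=0$. *)

(* Defs.v *)
From HB Require Import structures.
From mathcomp Require Import all_boot all_order all_algebra.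
From mathcomp Require Import all_classical all_reals all_analysis.
Set Implicit Arguments. Unset Strict Implicit. Unset Printing Implicit Defensive.
Import Order.TTheory GRing.Theory Num.Theory.
Import numFieldNormedType.Exports.
Local Open Scope classical_set_scope.
Local Open Scope ring_scope.

Notation plane R := (R * R)%type (only parsing).

(* The library norm on a product is the max norm, so the Euclidean structure
   is spelled out. *)
Definition dot (R : realType) (x y : plane R) : R := x.1 * y.1 + x.2 * y.2.

Definition enorm (R : realType) (x : plane R) : R := Num.sqrt (dot x x).

Definition leb2 (R : realType)
    : {measure set (measurableTypeR R * measurableTypeR R) -> \bar R} :=
  (@lebesgue_measure R \x @lebesgue_measure R)%E.

Definition boundary (R : realType) (A : set (plane R)) : set (plane R) :=
  closure A `\` A°.

Definition segment (R : realType) (a b : plane R) : set (plane R) :=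
  [set x | exists2 t : R, 0 <= t <= 1 & x = (1 - t) *: a + t *: b].

(** * Polygonal domains with Lipschitz boundary *)

(* In an orthonormal frame [e1, e2] centred at the boundary point [z], the set
   is locally the strict epigraph of a Lipschitz function. *)
Definition lipschitz_boundary (R : realType) (Omega : set (plane R)) : Prop :=
  forall z, boundary Omega z ->
  exists (e1 e2 : plane R) (r h : R) (g : R -> R),
    [/\ [/\ dot e1 e1 = 1, dot e2 e2 = 1 & dot e1 e2 = 0], 0 < r, 0 < h,
        [lipschitz g s | s in [set: R]] &
        forall s t : R, `|s| < r -> `|t| < h ->
          (Omega (z + s *: e1 + t *: e2) <-> g s < t)].

Definition polygonal_boundary (R : realType) (Omega : set (plane R)) : Prop :=
  exists l : seq (plane R * plane R),
    boundary Omega = \bigcup_(ab in [set` l]) segment ab.1 ab.2.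

Definition domain (R : realType) (Omega : set (plane R)) : Prop :=
  [/\ Omega !=set0, open Omega & connected Omega].

Definition lipschitz_polygon (R : realType) (Omega : set (plane R)) : Prop :=
  [/\ domain Omega, bounded_set Omega, polygonal_boundary Omega
    & lipschitz_boundary Omega].

(** * Triangulations *)

Definition triangle (R : realType) (a b c : plane R) : set (plane R) :=
  [set x | exists s t u : R, [/\ 0 <= s, 0 <= t, 0 <= u, s + t + u = 1
                              & x = s *: a + t *: b + u *: c]].

Definition noncollinear (R : realType) (a b c : plane R) : Prop :=
  (b.1 - a.1) * (c.2 - a.2) - (b.2 - a.2) * (c.1 - a.1) != 0.

Definition has_vertices (R : realType) (K : set (plane R)) (a b c : plane R) : Prop :=
  noncollinear a b c /\ K = triangle a b c.

Definition vertex (R : realType) (K : set (plane R)) (a : plane R) : Prop :=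
  exists b c, has_vertices K a b c.

Definition edge (R : realType) (K E : set (plane R)) : Prop :=
  exists a b c, has_vertices K a b c /\ E = segment a b.

Definition conforming (R : realType) (T : set (set (plane R))) : Prop :=
  forall K L, T K -> T L -> K <> L ->
  [\/ K `&` L = set0,
      exists a, [/\ vertex K a, vertex L a & K `&` L = [set a]]
    | exists E, [/\ edge K E, edge L E & K `&` L = E]].

(* The elements are closed nondegenerate triangles. *)
Definition triangulation (R : realType) (Omega : set (plane R))
    (T : set (set (plane R))) : Prop :=
  [/\ finite_set T, forall K, T K -> exists a b c, has_vertices K a b c,
      conforming T & \bigcup_(K in T) K = closure Omega].

Definition mesh_size (R : realType) (T : set (set (plane R))) : R :=
  sup [set d | exists K x y, [/\ T K, K x, K y & d = enorm (x - y)]].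

(* Every element contains a ball of diameter [rho] times the mesh size. *)
Definition quasi_uniform (R : realType) (rho : R) (T : set (set (plane R))) : Prop :=
  0 < rho /\
  forall K, T K -> exists z,
    [set x | 2 * enorm (x - z) <= rho * mesh_size T] `<=` K.

(** * Gradients and continuous piecewise linear functions *)

Definition grad (R : realType) (u : plane R -> R) (x : plane R) : plane R :=
  ('D_(1, 0) u x, 'D_(0, 1) u x).

(* Functions on Omega vanishing on its boundary are represented by their
   extension by zero to the plane. *)
Definition S_h (R : realType) (Omega : set (plane R)) (T : set (set (plane R)))
    : set (plane R -> R) :=
  [set v | [/\ continuous v,
               forall K, T K -> exists (c : R) (g : plane R),
                 forall x, K x -> v x = c + dot g x
             & forall x, ~ Omega x -> v x = 0]].

(* The gradient taken elementwise. The mesh skeleton, where a piecewise linear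
   function need not be differentiable, is a null set. *)
Definition pw_grad (R : realType) (T : set (set (plane R))) (v : plane R -> R)
    : plane R -> plane R :=
  grad v \_ (\bigcup_(K in T) K°).

Definition grad_nonvanishing (R : realType) (T : set (set (plane R)))
    (v : plane R -> R) : Prop :=
  forall K, T K -> forall x, K° x -> enorm (pw_grad T v x) != 0.

Definition flat_region (R : realType) (Omega : set (plane R))
    (T : set (set (plane R))) (v : plane R -> R) (S : set (plane R)) : Prop :=
  [/\ S !=set0, S `<=` Omega, connected S &
      exists2 F, F `<=` T /\
          (forall K, F K -> forall x, K° x -> enorm (pw_grad T v x) = 0)
        & S = (\bigcup_(K in F) K)°].

Definition maximal_flat_region (R : realType) (Omega : set (plane R))
    (T : set (set (plane R))) (v : plane R -> R) (S : set (plane R)) : Prop :=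
  flat_region Omega T v S /\
  forall S', flat_region Omega T v S' -> S `<=` S' -> S' = S.

Definition flat_regions_reach_boundary (R : realType) (Omega : set (plane R))
    (T : set (set (plane R))) (v : plane R -> R) : Prop :=
  forall S, maximal_flat_region Omega T v S ->
  exists K E, [/\ T K, edge K E & E `<=` boundary S `&` boundary Omega].

(** * Sobolev spaces *)

Definition smooth (R : realType) (phi : plane R -> R) : Prop :=
  forall (ds : seq (plane R)) (x : plane R),
    differentiable (foldr (fun d f => 'D_d f) phi ds) x.

Definition test_function (R : realType) (Omega : set (plane R))
    (phi : plane R -> R) : Prop :=
  smooth phi /\
  exists K : set (plane R), [/\ compact K, K `<=` Omega & forall x, ~ K x -> phi x = 0].

Definition weak_gradient (R : realType) (Omega : set (plane R))
    (w : plane R -> R) (G : plane R -> plane R) : Prop :=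
  forall phi, test_function Omega phi ->
    (\int[@leb2 R]_(x in Omega) (w x * (grad phi x).1)
      = - (\int[@leb2 R]_(x in Omega) ((G x).1 * phi x))) /\
    (\int[@leb2 R]_(x in Omega) (w x * (grad phi x).2)
      = - (\int[@leb2 R]_(x in Omega) ((G x).2 * phi x))).

Definition Lp (R : realType) (p : R) (Omega : set (plane R)) (f : plane R -> R) : Prop :=
  f \_ Omega \in Lfun (@leb2 R) p%:E.

Definition Lp_norm (R : realType) (p : R) (Omega : set (plane R))
    (f : plane R -> R) : \bar R :=
  'N[@leb2 R]_(p%:E)[EFin \o (f \_ Omega)].

(* [W1p p Omega w G]: w is in W^{1,p}(Omega) and G represents its weak gradient. *)
Definition W1p (R : realType) (p : R) (Omega : set (plane R))
    (w : plane R -> R) (G : plane R -> plane R) : Prop :=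
  [/\ Lp p Omega w, Lp p Omega (fun x => (G x).1), Lp p Omega (fun x => (G x).2)
    & weak_gradient Omega w G].

(* W_0^{1,p}(Omega) is the closure of the test functions in W^{1,p}(Omega). *)
Definition W1p0 (R : realType) (p : R) (Omega : set (plane R))
    (w : plane R -> R) (G : plane R -> plane R) : Prop :=
  W1p p Omega w G /\
  exists phi : nat -> plane R -> R,
    [/\ forall n, test_function Omega (phi n),
        (fun n => Lp_norm p Omega (fun x => phi n x - w x)) @ \oo --> 0%E
      & (fun n => Lp_norm p Omega (fun x => enorm (grad (phi n) x - G x))) @ \oo --> 0%E].

(* (a + b)^{p-2} a^2, with value 0 at a = b = 0. *)
Definition shifted_power (R : realType) (p a b : R) : R :=
  (a + b) `^ (p - 2) * a ^+ 2.

Definition PF_inequality (R : realType) (p : R) (Omega : set (plane R))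
    (T : set (set (plane R))) (v : plane R -> R) (C : R) : Prop :=
  forall w G, W1p0 p Omega w G ->
  (\int[@leb2 R]_(x in Omega) (shifted_power p `|w x| (enorm (pw_grad T v x)))%:E
   <= C%:E *
   \int[@leb2 R]_(x in Omega) (shifted_power p (enorm (G x)) (enorm (pw_grad T v x)))%:E)%E.

(* Main.v *)
(* The shifted power [psi a b = (a + b)^(p - 2) a^2] is increasing and convex in
   [a] and decreasing in [b]. Integrating along segments, Jensen's inequality,
   Tonelli's theorem and translation invariance turn any bound of [|f x|] by the
   integral of [|grad f|] along a fixed vector [d] starting at [x] into a modular
   inequality between [psi |f| b] and [psi |grad f| b], for constant [b].

   Where [|grad v|] is positive, compare it with an upper bound [M]: leaving the
   bounded set along a long vector gives a modular Poincare inequality with shift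
   [M] on the whole plane, and its right-hand side only increases when [M] is
   replaced by [|grad v|]. The resulting constant is an explicit function of the
   slopes of [v], hence continuous as long as no slope vanishes.

   Where [grad v = 0] one needs a Poincare inequality for [|f|^p] on the maximal
   flat region. The edge on the boundary contains two distinct points of some
   element of the region, and the triangle they span with a third point of that
   element can be swept towards that part of the edge, where [f = 0]. Translations
   within the region propagate the estimate to all its points by connectedness,
   and then up to the boundary of each element by convexity. *)

(* The obstacle is that Jensen's inequality tolerates only one constant shift, while a segment
   leaving an element meets elements with other slopes. Raising the shift from [b] to [M] on the
   left costs a factor [M / b], and lowering it again on the gradient side is free. For [b = 0] this
   factor is infinite, so on a flat element the segments have to stay among flat elements all the
   way to a zero of [f]. This is what the boundary edge is for. Everything along segments is done
   for C1 functions extended by zero. The passage to [W1p0] rests on two properties of [psi], namely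
   [psi a b <= a^p] and [psi (a + a') b <= 4 (psi a b + psi a' b)]. The second is used once for [w]
   and once for its gradient, whence the factor 16 in all final constants. Integrals are kept
   nonnegative and extended-valued throughout, so finiteness of either side never has to be known
   beforehand. *)
Require Import Defs.
From HB Require Import structures.
From mathcomp Require Import all_boot all_order all_algebra.
From mathcomp Require Import all_classical all_reals all_analysis.
From mathcomp Require Import measurable_realfun ring lra.
Set Implicit Arguments. Unset Strict Implicit. Unset Printing Implicit Defensive.
Import Order.TTheory GRing.Theory Num.Theory.
Import numFieldNormedType.Exports.
Local Open Scope classical_set_scope.
Local Open Scope ring_scope.

(** * Shifted powers *)

Section shifted_power.
Context {R : realType} (p : R).
Hypothesis hp : 1 < p < 2.
Implicit Types a b s m : R.

Lemma powR_le_tangent m s a : 0 < m -> 0 <= s -> 0 < a < 1 ->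
  s `^ a <= m `^ a + a * m `^ a / m * (s - m).
Proof.
move=> m0 s0 /andP[a0 a1].
have q0 : 0 < 1 - a by lra.
have := @conjugate_powR R ((s / m) `^ a) 1 a^-1 (1 - a)^-1.
rewrite powR_ge0 ler01 !invr_gt0 a0 q0 !invrK => /(_ isT isT isT isT).
rewrite -powRrM divff ?gt_eqF// powR1 powRr1; last by rewrite divr_ge0// ltW.
rewrite mulr1 mul1r => /(_ ltac:(by rewrite addrC subrK)) h.
have -> : s `^ a = m `^ a * (s / m) `^ a.
  rewrite -powRM ?(ltW m0)//; last by rewrite divr_ge0// ltW.
  by rewrite mulrC divfK// gt_eqF.
have M0 : 0 < m `^ a by rewrite powR_gt0.
apply: (le_trans (ler_wpM2l (ltW M0) h)).
rewrite le_eqVlt; apply/orP; left; apply/eqP; field.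
by rewrite gt_eqF.
Qed.

Lemma shifted_power_ge0 a b : 0 <= shifted_power p a b.
Proof. by rewrite /shifted_power mulr_ge0 ?powR_ge0 ?sqr_ge0. Qed.

Lemma shifted_power0 b : shifted_power p 0 b = 0.
Proof. by rewrite /shifted_power expr0n mulr0. Qed.

Lemma shifted_powerE a b : shifted_power p a b = a ^+ 2 / (a + b) `^ (2 - p).
Proof. by rewrite /shifted_power mulrC -powRN opprB. Qed.

(* Convexity, via [s^2 / y >= 2 (m / Y) s - (m / Y)^2 y] and the concavity of
   [s |-> (s + b) `^ (2 - p)]. *)
Lemma shifted_power_tangent m b : 0 <= m -> 0 <= b -> exists2 l : R, 0 <= l &
  forall s, 0 <= s -> shifted_power p m b + l * s <= shifted_power p s b + l * m.
Proof.
case/andP: (hp) => p1 p2.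
rewrite le_eqVlt => /predU1P[<- b0|m0 b0].
  exists 0 => // s s0; rewrite !mul0r !addr0 shifted_power0.
  exact: shifted_power_ge0.
set a := 2 - p; have ha : 0 < a < 1 by apply/andP; split; rewrite /a; lra.
have mb : 0 < m + b by lra.
set Y := (m + b) `^ a; have Y0 : 0 < Y by rewrite powR_gt0.
(* The derivative of [shifted_power p _ b] at [m]. *)
set l := 2 * m / Y - a * m ^+ 2 / (Y * (m + b)).
have l0 : 0 <= l.
  have -> : l = m / Y * ((2 * b + (2 - a) * m) / (m + b)).
    by rewrite /l; field; rewrite ?gt_eqF.
  apply: mulr_ge0; first by rewrite divr_ge0// ltW.
  apply: divr_ge0; last exact: ltW.
  by case/andP: ha => *; nra.
exists l => // s s0.
have [sb|sb] := eqVneq (s + b) 0.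
  have -> : s = 0 by lra.
  have b00 : b = 0 by lra.
  rewrite shifted_power0 mulr0 addr0 add0r shifted_powerE /l /Y -/a b00 addr0.
  have M0 : 0 < m `^ a by rewrite powR_gt0.
  rewrite -subr_ge0.
  have -> : (2 * m / m `^ a - a * m ^+ 2 / (m `^ a * m)) * m - m ^+ 2 / m `^ a
    = m ^+ 2 / m `^ a * (1 - a) by field; rewrite ?gt_eqF.
  rewrite mulr_ge0 ?divr_ge0 ?sqr_ge0 ?powR_ge0//.
  by case/andP: ha; lra.
have {sb}sb : 0 < s + b by lra.
have h := @powR_le_tangent (m + b) (s + b) a mb (ltW sb) ha.
rewrite !shifted_powerE -/a -/Y; move: h; rewrite -/Y.
set y := (s + b) `^ a => h.
have y0 : 0 < y by rewrite powR_gt0.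
have h1 : 2 * (m / Y) * s - (m / Y) ^+ 2 * y <= s ^+ 2 / y.
  rewrite -subr_ge0.
  have -> : s ^+ 2 / y - (2 * (m / Y) * s - (m / Y) ^+ 2 * y) =
    (s - m / Y * y) ^+ 2 / y by field; rewrite ?gt_eqF.
  by rewrite divr_ge0 ?sqr_ge0// ltW.
have h2 := ler_wpM2l (sqr_ge0 (m / Y)) h.
have E : m ^+ 2 / Y + l * s - l * m = 2 * (m / Y) * s -
   (m / Y) ^+ 2 * (Y + a * Y / (m + b) * (s + b - (m + b))).
  by rewrite /l; field; rewrite ?gt_eqF.
move: h1 h2 E; lra.
Qed.

Lemma ler_shifted_powerl a a' b : 0 <= a -> 0 <= b -> a <= a' ->
  shifted_power p a b <= shifted_power p a' b.
Proof.
move=> a0 b0 aa'.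
have [l l0 /(_ _ (le_trans a0 aa'))] := shifted_power_tangent a0 b0.
have := ler_wpM2l l0 aa'; lra.
Qed.

Lemma ler_shifted_powerr a b b' : 0 <= a -> 0 <= b -> b <= b' ->
  shifted_power p a b' <= shifted_power p a b.
Proof.
case/andP: (hp) => p1 p2.
rewrite le_eqVlt => /predU1P[<-|a0] b0 bb'; first by rewrite !shifted_power0.
rewrite !shifted_powerE ler_wpM2l ?sqr_ge0// lef_pV2 ?posrE ?powR_gt0//; try lra.
by apply: ge0_ler_powR; rewrite ?nnegrE; lra.
Qed.

Lemma shifted_power_powR a : 0 <= a -> shifted_power p a 0 = a `^ p.
Proof.
case/andP: (hp) => p1 p2.
rewrite le_eqVlt => /predU1P[<-|a0].
  by rewrite shifted_power0 powR0//; apply/eqP; lra.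
rewrite /shifted_power addr0 -(powR_mulrn 2 (ltW a0)) -powRD ?subrK//.
by apply/implyP => _; rewrite gt_eqF.
Qed.

Lemma shifted_power_le_powR a b : 0 <= a -> 0 <= b ->
  shifted_power p a b <= a `^ p.
Proof. by move=> a0 b0; rewrite -shifted_power_powR// ler_shifted_powerr. Qed.

(** The ratio of both sides without the factor is the power [2 - p < 1] of [(a + b') / (a + b)], a
    number between [1] and [b' / b]. This factor later becomes the quotient of slopes in the
    constant. *)
Lemma shifted_power_shift_le a b b' : 0 <= a -> 0 < b -> b <= b' ->
  shifted_power p a b <= b' / b * shifted_power p a b'.
Proof.
case/andP: (hp) => p1 p2.
move=> a0 b0 bb'; have b'0 : 0 < b' by lra.
rewrite !shifted_powerE mulrCA ler_wpM2l ?sqr_ge0//.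
set A := (a + b) `^ _; set B := (a + b') `^ _.
have A0 : 0 < A by rewrite powR_gt0; lra.
have B0 : 0 < B by rewrite powR_gt0; lra.
suff : B / A <= b' / b.
  by rewrite -(ler_pM2r B0) divfK ?gt_eqF// [in X in _ -> X]mulrC.
have -> : B / A = ((a + b') / (a + b)) `^ (2 - p).
  rewrite powRM ?invr_ge0; [|lra|lra].
  by rewrite -[(a + b)^-1]powR_inv1 -?powRrM ?mulN1r ?powRN//; lra.
have ab : 1 <= (a + b') / (a + b) by rewrite ler_pdivlMr; lra.
apply: (@le_trans _ _ ((a + b') / (a + b))); first by apply: ler1_powR => //; lra.
rewrite ler_pdivrMr; last lra.
rewrite mulrAC ler_pdivlMr//; nra.
Qed.

(** The numerator gains [k ^+ 2] and the denominator can only grow. *)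
Lemma shifted_powerM_le k a b : 1 <= k -> 0 <= a -> 0 <= b ->
  shifted_power p (k * a) b <= k ^+ 2 * shifted_power p a b.
Proof.
case/andP: (hp) => p1 p2.
move=> k1; rewrite le_eqVlt => /predU1P[<-|a0] b0.
  by rewrite mulr0 !shifted_power0 mulr0.
rewrite !shifted_powerE exprMn -mulrA ler_wpM2l ?sqr_ge0//.
rewrite ler_wpM2l ?sqr_ge0// lef_pV2 ?posrE ?powR_gt0//; try nra.
by apply: ge0_ler_powR; rewrite ?nnegrE; nra.
Qed.

(** Substitute for the triangle inequality: the sum is at most twice the larger term, and
    [4 = 2 ^+ 2]. *)
Lemma shifted_powerD_le a a' b : 0 <= a -> 0 <= a' -> 0 <= b ->
  shifted_power p (a + a') b <= 4 * (shifted_power p a b + shifted_power p a' b).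
Proof.
move=> a0 a'0 b0; wlog aa' : a a' a0 a'0 / a <= a'.
  move=> W; have [|/ltW] := leP a a'; first exact: W.
  by move/(W _ _ a'0 a0); rewrite addrC (addrC (shifted_power p a' b)).
apply: (@le_trans _ _ (shifted_power p (2 * a') b)).
  by apply: ler_shifted_powerl => //; lra.
apply: (le_trans (@shifted_powerM_le 2 a' b _ _ _)) => //; first lra.
have := shifted_power_ge0 a b; have := shifted_power_ge0 a' b.
rewrite expr2; lra.
Qed.

Lemma measurable_shifted_power d (X : measurableType d) (D : set X)
    (f g : X -> R) : measurable_fun D f -> measurable_fun D g ->
  measurable_fun D (fun x => shifted_power p (f x) (g x)).
Proof.
move=> mf mg; apply: measurable_funM; last exact: measurable_funX.
by apply: (measurableT_comp (measurable_powR _)); exact: measurable_funD.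
Qed.

End shifted_power.

#[global] Hint Extern 0 (is_true (0 <= shifted_power _ _ _)) =>
  solve [apply: shifted_power_ge0] : core.

(** * Lebesgue measure on the plane *)

Notation mplane R := (measurableTypeR R * measurableTypeR R)%type (only parsing).

Section plane_measure.
Context {R : realType}.
Local Notation mu := (@leb2 R).

Lemma measurable_plane_ball (x : plane R) (e : R) :
  measurable (ball x e : set (mplane R)).
Proof.
have -> : (ball x e : set (mplane R)) = ball x.1 e `*` ball x.2 e by [].
by apply: measurableX; rewrite ball_itv; exact: measurable_itv.
Qed.

(** The sigma-algebra is the product one. Balls of the max norm are rectangles, and an open set is
    the countable union of the balls with rational centre and radius [1 / (n + 1)] that it
    contains. *)
Lemma measurable_plane_open (U : set (plane R)) :
  open U -> measurable (U : set (mplane R)).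
Proof.
move=> oU.
pose B (i : rat * rat * nat) : set (plane R) :=
  ball ((ratr i.1.1, ratr i.1.2) : plane R) i.2.+1%:R^-1.
have -> : U = \bigcup_i (if `[< B i `<=` U >] then B i else set0).
  apply/seteqP; split => [x Ux|x [i _]]; last by by case: asboolP => // BU; exact: BU.
  have /nbhs_ballP[e /= e0 eU] := open_nbhs_nbhs (conj oU Ux).
  have e20 : 0 < e / 2 by rewrite divr_gt0.
  have [n ne] : exists n : nat, n.+1%:R^-1 < e / 2.
    by have [n _ /(_ n (leqnn n))] := near_infty_natSinv_lt (PosNum e20); exists n.
  have n0 : 0 < n.+1%:R^-1 :> R by rewrite invr_gt0.
  have [q1 q1x] : exists q : rat, ball (ratr q : R) n.+1%:R^-1 x.1.
    have /rat_in_itvoo[q /[!in_itv]/= /andP[q1 q2]] : x.1 - n.+1%:R^-1 < x.1 + n.+1%:R^-1.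
      by rewrite ltrBlDr -addrA ltrDl addr_gt0.
    by exists q; rewrite ball_itv/= in_itv/= ltrBlDr -[X in _ && X]ltrBlDr; apply/andP.
  have [q2 q2x] : exists q : rat, ball (ratr q : R) n.+1%:R^-1 x.2.
    have /rat_in_itvoo[q /[!in_itv]/= /andP[q2 q3]] : x.2 - n.+1%:R^-1 < x.2 + n.+1%:R^-1.
      by rewrite ltrBlDr -addrA ltrDl addr_gt0.
    by exists q; rewrite ball_itv/= in_itv/= ltrBlDr -[X in _ && X]ltrBlDr; apply/andP.
  exists (q1, q2, n) => //; rewrite asboolT// => y [/= y1 y2]; apply: eU.
  have half (z1 z2 : R) : ball z1 n.+1%:R^-1 z2 -> ball z1 (e / 2) z2.
    exact/le_ball/ltW.
  rewrite [e]splitr; split.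
    exact: (ball_triangle (half _ _ (ball_sym q1x)) (half _ _ y1)).
  exact: (ball_triangle (half _ _ (ball_sym q2x)) (half _ _ y2)).
apply: countable_bigcupT_measurable => // i; case: asboolP => // _.
exact: measurable_plane_ball.
Qed.

Lemma measurable_plane_closed (U : set (plane R)) :
  closed U -> measurable (U : set (mplane R)).
Proof.
move=> cU; rewrite -[U]setCK; apply: measurableC.
by apply: measurable_plane_open; exact: closed_openC.
Qed.

Lemma continuous_plane_measurable (f : plane R -> R) : continuous f ->
  measurable_fun (setT : set (mplane R)) f.
Proof.
move=> /continuousP cf; apply: (measurability _ (RGenOpens.measurableE R)). 
move=> _ [_ [a [b ->] <-]]; rewrite setTI; apply: measurable_plane_open.
by apply: cf; exact: interval_open.
Qed.

(** By uniqueness of the measure giving half-open intervals their length. The planar version below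
    uses in the same way uniqueness of the product measure on rectangles. *)
Lemma lebesgue_measure_shift (c : R) (A : set (measurableTypeR R)) :
  measurable A ->
  pushforward (@lebesgue_measure R)
    (fun x => x + c : measurableTypeR R) A = @lebesgue_measure R A.
Proof.
move=> mA.
have mphi : measurable_fun setT (fun x : measurableTypeR R => x + c : measurableTypeR R).
  exact: measurable_funD.
pose mphi' := isMeasurableFun.Build _ _ _ _ _ mphi.
pose phi : {mfun measurableTypeR R >-> measurableTypeR R} :=
  HB.pack (fun x : measurableTypeR R => x + c : measurableTypeR R) mphi'.
apply/esym/(@lebesgue_measure_unique R (pushforward _ phi)) => // _ [[a b]] _ <-.
rewrite /pushforward/=.
rewrite [X in _ = lebesgue_measure X](_ : _ = `]a - c, b - c]%classic).
  rewrite !lebesgue_measure_itv/= !lte_fin ltrD2r.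
  by case: ifP => // _; rewrite -!EFinD; congr EFin; ring.
by apply/seteqP; split => x /=; rewrite !in_itv/= ltrBlDr lerBrDr.
Qed.

Lemma measurable_plane_shift (d : plane R) :
  measurable_fun setT (fun x : mplane R => (x + d : mplane R)).
Proof.
have -> : (fun x : mplane R => (x + d : mplane R)) =
  (fun x => (x.1 + d.1, x.2 + d.2)) by [].
by apply: measurable_fun_pair; apply: measurable_funD.
Qed.

Lemma leb2_shift (d : plane R) (A : set (mplane R)) : measurable A ->
  pushforward mu (fun x => x + d : mplane R) A = mu A.
Proof.
move=> mA.
have mphi := measurable_plane_shift d.
pose mphi' := isMeasurableFun.Build _ _ _ _ _ mphi.
pose phi : {mfun mplane R >-> mplane R} :=
  HB.pack (fun x : mplane R => (x + d : mplane R)) mphi'.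
apply/esym; have := @product_measure_unique _ _ _ _ R lebesgue_measure
  lebesgue_measure (pushforward mu phi) _ A mA; apply => X Y mX mY.
transitivity ((lebesgue_measure \x lebesgue_measure)%E
  (((fun x : measurableTypeR R => x + d.1 : measurableTypeR R) @^-1` X) `*`
   ((fun x : measurableTypeR R => x + d.2 : measurableTypeR R) @^-1` Y))) => //.
have mD (c : R) : measurable_fun setT (fun x : measurableTypeR R => x + c : measurableTypeR R).
  exact: measurable_funD.
rewrite product_measure1E//.
- by congr (_ * _)%E; exact: lebesgue_measure_shift.
- by rewrite -[_ @^-1` _]setTI; exact: mD.
- by rewrite -[_ @^-1` _]setTI; exact: mD.
Qed.

Lemma ge0_integral_leb2_shift (d : plane R) (A : set (mplane R))
    (f : mplane R -> \bar R) : measurable A ->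
  measurable_fun A f -> (forall x, (0 <= f x)%E) ->
  (\int[mu]_(x in [set x : mplane R | A (x + d)%R]) f (x + d)%R = \int[mu]_(x in A) f x)%E.
Proof.
move=> mA mf f0; have mphi := measurable_plane_shift d.
have f0A : {in A, forall y, (0 <= f y)%E} by move=> y _; exact: f0.
apply: etrans (esym (@ge0_integral_pushforward _ _ _ _ _ _ mphi mu A f mA mf f0A)) _.
by apply: eq_measure_integral => //= B mB BA; exact: leb2_shift.
Qed.

Lemma leb2_sigma_finite : sigma_finite setT mu.
Proof.
exists (fun n : nat => ball (0 : plane R) n.+1%:R).
  apply/esym/seteqP; split => // x _.
  have /ltW x1 := archi_boundP (normr_ge0 x.1).
  have /ltW x2 := archi_boundP (normr_ge0 x.2).
  exists (maxn (Num.bound `|x.1|) (Num.bound `|x.2|)) => //.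
  split; rewrite -ball_normE/= sub0r normrN.
    by rewrite (le_lt_trans x1)// ltr_nat ltnS leq_maxl.
  by rewrite (le_lt_trans x2)// ltr_nat ltnS leq_maxr.
move=> n; split; first exact: measurable_plane_ball.
have -> : (ball (0 : plane R) n.+1%:R : set (mplane R)) =
  ball (0 : R) n.+1%:R `*` ball (0 : R) n.+1%:R by [].
have mb : measurable (ball (0 : R) n.+1%:R : set (measurableTypeR R)).
  by rewrite ball_itv; exact: measurable_itv.
have fb : (@lebesgue_measure R (ball (0 : R)%R n.+1%:R) < +oo)%E.
  by rewrite lebesgue_measure_ball// ltey.
rewrite /leb2/= product_measure1E//.
by apply: lte_mul_pinfty => //; rewrite ge0_fin_numE.
Qed.

(* The sigma-finite structure inferred for [\x] only covers sub-probabilities. *)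
Definition leb2_sf : {sigma_finite_measure set (mplane R) -> \bar R} :=
  HB.pack (@leb2 R : set (mplane R) -> \bar R) (Measure.class (@leb2 R))
    (Measure_isSigmaFinite.Build _ _ _ (@leb2 R) leb2_sigma_finite).

Lemma leb2_line (a b c : R) : (a != 0) || (b != 0) ->
  mu [set x | a * x.1 + b * x.2 = c] = 0%E.
Proof.
move=> ab; rewrite /leb2 /=.
have [b0|b0] := eqVneq b 0.
  move: ab; rewrite b0 eqxx orbF => a0.
  have -> : [set x : mplane R | a * x.1 + 0 * x.2 = c] = [set c / a] `*` setT.
    apply/seteqP; split => [[x y]|[x y]] /=; rewrite mul0r addr0.
      by move=> <-; split=> //; rewrite mulrAC divff// mul1r.
    by case=> -> _; rewrite mulrC divfK.
  rewrite product_measure1E//.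
  exact: etrans (congr1 (fun z => z * _)%E (lebesgue_measure_set1 (c / a))) (mul0e _).
rewrite /product_measure1 integral0_eq// => x _ /=.
have -> : xsection [set x : mplane R | a * x.1 + b * x.2 = c] x = [set (c - a * x) / b].
  apply/seteqP; split => y; rewrite /xsection/= inE/=.
    by move=> <-; rewrite addrC addKr mulrAC divff// mul1r.
  by move=> ->; rewrite [b * _]mulrC divfK// addrC subrK.
exact: lebesgue_measure_set1.
Qed.

End plane_measure.

(** * Jensen's inequality along segments *)

Section enorm.
Context {R : realType}.
Implicit Types x y : plane R.

Lemma enorm_ge0 x : 0 <= enorm x.
Proof. exact: sqrtr_ge0. Qed.

Lemma dot_ge0 x : 0 <= dot x x.
Proof. by rewrite /dot addr_ge0// -expr2 sqr_ge0. Qed.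

Lemma sqr_enorm x : enorm x ^+ 2 = dot x x.
Proof. by rewrite /enorm sqr_sqrtr// dot_ge0. Qed.

Lemma normr_le_enorm1 x : `|x.1| <= enorm x.
Proof.
rewrite -sqrtr_sqr /enorm ler_sqrt ?dot_ge0// /dot expr2 lerDl.
by rewrite -expr2 sqr_ge0.
Qed.

Lemma normr_le_enorm2 x : `|x.2| <= enorm x.
Proof.
rewrite -sqrtr_sqr /enorm ler_sqrt ?dot_ge0// /dot expr2 lerDr.
by rewrite -expr2 sqr_ge0.
Qed.

Lemma enorm0 : enorm (0 : plane R) = 0.
Proof. by rewrite /enorm /dot !mulr0 addr0 sqrtr0. Qed.

Lemma dot_le_enorm x y : dot x y <= enorm x * enorm y.
Proof.
have [|h] := leP (dot x y) 0.
  by move/le_trans; apply; rewrite mulr_ge0// enorm_ge0.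
rewrite -(@ler_pXn2r _ 2)//; last 2 first.
- by rewrite nnegrE ltW.
- by rewrite nnegrE mulr_ge0// enorm_ge0.
rewrite exprMn !sqr_enorm /dot; have := sqr_ge0 (x.1 * y.2 - x.2 * y.1).
by nra.
Qed.

Lemma enormD x y : enorm (x + y) <= enorm x + enorm y.
Proof.
rewrite -(@ler_pXn2r _ 2)// ?nnegrE ?addr_ge0 ?enorm_ge0//.
rewrite sqrrD !sqr_enorm; have := dot_le_enorm x y.
rewrite /dot /=; lra.
Qed.

Lemma measurable_enorm d (X : measurableType d) (D : set X) (f : X -> plane R) :
  measurable_fun D (fun t => (f t).1) -> measurable_fun D (fun t => (f t).2) ->
  measurable_fun D (fun t => enorm (f t)).
Proof.
move=> m1 m2; apply: (measurableT_comp (f := @Num.sqrt R)).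
  by apply: continuous_measurable_fun; exact: sqrt_continuous.
by apply: measurable_funD; apply: measurable_funM.
Qed.

End enorm.

#[global] Hint Extern 0 (is_true (0 <= enorm _)) => solve [apply: enorm_ge0] : core.

Section averaging.
Context {R : realType} (p : R).
Hypothesis hp : 1 < p < 2.
Local Notation mu := (@leb2 R).
Local Notation leb := (@lebesgue_measure R).

(** Integrates the tangent inequality at [m]. Its slope is nonnegative, so a lower bound [m] for the
    mean of [h] is enough, and the term [l * m] stays on the right so that all integrands are
    nonnegative even when [h] is not integrable. *)
Lemma shifted_power_jensen (h : R -> R) (m b : R) : 0 <= m -> 0 <= b ->
  measurable_fun (`[0%R, 1%R] : set (measurableTypeR R)) h -> (forall t, 0 <= h t) ->
  (m%:E <= \int[leb]_(t in `[0%R, 1%R]) (h t)%:E)%E ->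
  ((shifted_power p m b)%:E <=
     \int[leb]_(t in `[0%R, 1%R]) (shifted_power p (h t) b)%:E)%E.
Proof.
move=> m0 b0 mh h0 hm.
have [l l0 tan] := shifted_power_tangent hp m0 b0.
have mpsi : measurable_fun (`[0%R, 1%R] : set (measurableTypeR R))
    (fun t => shifted_power p (h t) b) by exact: measurable_shifted_power.
have lebI : (leb `[0%R, 1%R] = 1)%E.
  by rewrite lebesgue_measure_itv/= lte_fin ltr01 oppr0 adde0.
have cstI (r : R) : (\int[leb]_(t in `[0%R, 1%R]) r%:E = r%:E)%E.
  rewrite integral_cst//.
  exact: etrans (congr1 (fun z => r%:E * z)%E lebI) (mule1 _).
rewrite -(@leeD2rE _ (l * m)%:E)//.
apply: (@le_trans _ _ ((shifted_power p m b)%:E +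
    l%:E * \int[leb]_(t in `[0%R, 1%R]) (h t)%:E)%E).
  by rewrite leeD2l// EFinM lee_wpmul2l.
rewrite -ge0_integralZl_EFin//; last exact/measurable_EFinP.
  rewrite -[in leLHS](cstI (shifted_power p m b)) -[in leRHS](cstI (l * m)).
  rewrite -!ge0_integralD//.
  - apply: ge0_le_integral => //.
    + move=> t _; apply: adde_ge0; first by rewrite lee_fin.
      by rewrite -EFinM lee_fin mulr_ge0.
    + apply: emeasurable_funD => //.
      by apply: emeasurable_funM => //; exact/measurable_EFinP.
    + by apply: emeasurable_funD => //; exact/measurable_EFinP.
    + by move=> t _; rewrite -EFinM -!EFinD lee_fin tan.
  - by move=> t _; rewrite lee_fin shifted_power_ge0.
  - exact/measurable_EFinP.
  - by move=> t _; rewrite lee_fin mulr_ge0.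
  - by move=> t _; rewrite lee_fin shifted_power_ge0.
  - by move=> t _; rewrite -EFinM lee_fin mulr_ge0.
  - by apply: emeasurable_funM => //; exact/measurable_EFinP.
by move=> t _; rewrite lee_fin.
Qed.

Lemma measurable_segment_path (d : plane R) :
  measurable_fun setT (fun z : mplane R * measurableTypeR R =>
    (z.1 + z.2 *: d : mplane R)).
Proof.
have -> : (fun z : mplane R * measurableTypeR R => (z.1 + z.2 *: d : mplane R)) =
  (fun z => (z.1.1 + z.2 * d.1, z.1.2 + z.2 * d.2)) by [].
by apply: measurable_fun_pair; apply: measurable_funD;
  [exact: measurableT_comp|exact: measurable_funM|
   exact: measurableT_comp|exact: measurable_funM].
Qed.

(* Jensen in [t], then Tonelli and translation invariance. *)
Lemma shifted_power_transport (A : set (mplane R)) (F g : plane R -> R)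
    (d : plane R) (b : R) : measurable A ->
  measurable_fun A F -> measurable_fun (setT : set (mplane R)) g ->
  (forall x, 0 <= g x) -> 0 <= b ->
  (forall x, A x ->
    ((`|F x|)%:E <= \int[leb]_(t in `[0%R, 1%R]) (g (x + t *: d))%:E)%E) ->
  (\int[mu]_(x in A) (shifted_power p `|F x| b)%:E <=
   \int[mu]_x (shifted_power p (g x) b)%:E)%E.
Proof.
move=> mA mF mg g0 b0 Fg.
(* The indicator turns the integral over [[0, 1]] into one over the line, so that Tonelli applies on
   the full product. *)
pose G (z : mplane R * measurableTypeR R) : R :=
  shifted_power p (g (z.1 + z.2 *: d)) b * \1_`[0%R, 1%R] z.2.
have mgp : measurable_fun setT (fun z : mplane R * measurableTypeR R => g (z.1 + z.2 *: d)).
  exact: (measurableT_comp mg (measurable_segment_path d)).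
have mG : measurable_fun setT G.
  apply: measurable_funM; first exact: measurable_shifted_power.
  by apply: measurableT_comp => //; exact: measurable_indic.
have G0 z : (0 <= (G z)%:E)%E.
  by rewrite lee_fin mulr_ge0 ?shifted_power_ge0.
have GE x : (\int[leb]_t (G (x, t))%:E =
    \int[leb]_(t in `[0%R, 1%R]) (shifted_power p (g (x + t *: d)) b)%:E)%E.
  rewrite [RHS]integral_mkcond; apply: eq_integral => t _.
  by rewrite /G patchE/= indicE; case: ifPn => _; rewrite ?mulr1 ?mulr0.
(* Once the right-hand side is finite, it can be treated as a real constant in the integral over
   [t]. *)
have [/eqP ->|Ifin] := boolP ((\int[mu]_x (shifted_power p (g x) b)%:E == +oo)%E).
  exact: leey.
have mF1 : measurable_fun setT (fun x : mplane R => \int[leb]_t (G (x, t))%:E)%E.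
  have mGE : measurable_fun setT (EFin \o G) by exact/measurable_EFinP.
  refine (@measurable_fun_fubini_tonelli_F _ _ _ _ R leb _ mGE G0).
apply: (@le_trans _ _ (\int[mu]_(x in A) \int[leb]_t (G (x, t))%:E)%E).
  apply: ge0_le_integral => //.
  - by move=> x _; rewrite lee_fin shifted_power_ge0.
  - apply/measurable_EFinP; apply: measurable_shifted_power => //.
    exact: measurableT_comp.
  - exact: measurable_funTS.
  - move=> x Ax; rewrite GE; apply: shifted_power_jensen => //; last exact: Fg.
    by apply: measurable_funTS; exact: (measurable_fun_pair2 x mgp).
apply: (@le_trans _ _ (\int[mu]_x \int[leb]_t (G (x, t))%:E)%E).
  apply: ge0_subset_integral => //.
  by move=> x _; apply: integral_ge0 => t _; exact: G0.
have mGE : measurable_fun setT (EFin \o G) by exact/measurable_EFinP.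
rewrite [leLHS](_ : _ = \int[leb]_t \int[mu]_x (G (x, t))%:E)%E; last first.
  exact: (@fubini_tonelli _ _ _ _ R (@leb2_sf R) leb _ mGE G0).
pose I := (\int[mu]_x (shifted_power p (g x) b)%:E)%E.
have I0 : (0 <= I)%E by apply: integral_ge0 => x _; rewrite lee_fin.
have If : I \is a fin_num by rewrite ge0_fin_numE// lt_neqAle leey andbT.
apply: (@le_trans _ _ (\int[leb]_(t in `[0%R, 1%R]) (fine I)%:E)%E); last first.
  rewrite integral_cst// fineK// -[leRHS]mule1 lee_wpmul2l//.
  by rewrite [leLHS]lebesgue_measure_itv/= lte_fin ltr01 oppr0 adde0.
rewrite [leRHS]integral_mkcond; apply: ge0_le_integral => //.
- by move=> t _; apply: integral_ge0 => x _; exact: G0.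
- exact: (@measurable_fun_fubini_tonelli_G _ _ _ _ R (@leb2_sf R) _ mGE G0).
- by apply/(measurable_restrictT _ _).1.
move=> t _; rewrite patchE; case: ifPn => t01; last first.
  rewrite integral0_eq// => x _; rewrite /G /= indicE (negbTE t01) mulr0//.
rewrite fineK//; have mgb : measurable_fun (setT : set (mplane R))
    (fun x => (shifted_power p (g x) b)%:E).
  by apply/measurable_EFinP; exact: measurable_shifted_power.
have := @ge0_integral_leb2_shift R (t *: d) setT
  (fun x => (shifted_power p (g x) b)%:E) measurableT mgb.
rewrite -/I => <-; last by move=> x; rewrite lee_fin.
by under eq_integral do rewrite /G /= indicE t01 mulr1.
Qed.

End averaging.

(** * Functions of class C1 *)

(** All directional derivatives are asked to be continuous because the fundamental theorem of
    calculus is applied along segments of arbitrary direction. *)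
Definition C1 (R : realType) (f : plane R -> R) : Prop :=
  (forall x, differentiable f x) /\ (forall d, continuous ('D_d f)).

Section C1_theory.
Context {R : realType}.
Local Notation mu := (@leb2 R).
Local Notation leb := (@lebesgue_measure R).
Implicit Types (f : plane R -> R) (x d : plane R).

Lemma smooth_C1 f : smooth f -> C1 f.
Proof.
move=> sf; split=> [x|d x]; first exact: (sf [::] x).
exact/differentiable_continuous/(sf [:: d] x).
Qed.

Lemma C1_continuous f : C1 f -> continuous f.
Proof. by case=> df _ x; exact: differentiable_continuous. Qed.

Lemma C1_measurable f : C1 f -> measurable_fun (setT : set (mplane R)) f.
Proof. by move/C1_continuous/continuous_plane_measurable. Qed.

Lemma measurable_enorm_grad f : C1 f ->
  measurable_fun (setT : set (mplane R)) (fun x => enorm (grad f x)).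
Proof.
case=> _ cf; apply: (@measurable_enorm R _ (mplane R)).
  exact: (continuous_plane_measurable (cf _)).
exact: (continuous_plane_measurable (cf _)).
Qed.

Lemma deriveE_grad f x d : differentiable f x -> 'D_d f x = dot d (grad f x).
Proof.
move=> df; rewrite /dot /grad/= !deriveE//.
have -> : d = d.1 *: ((1, 0) : plane R) + d.2 *: ((0, 1) : plane R).
  by case: d => d1 d2; congr pair => /=; rewrite ?scaler0 ?addr0 ?add0r -[_ *: _]/(_ * _) mulr1.
by rewrite linearD !linearZ /= ?scaler0 ?addr0 ?add0r -![_ *: 1]/(_ * 1) !mulr1.
Qed.

Lemma norm_derive_le f x d : differentiable f x ->
  `|'D_d f x| <= (`|d.1| + `|d.2|) * enorm (grad f x).
Proof.
move=> df; rewrite deriveE_grad// /dot mulrDl.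
apply: (le_trans (ler_normD _ _)); rewrite !normrM lerD// ler_wpM2l//.
  exact: normr_le_enorm1.
exact: normr_le_enorm2.
Qed.

Lemma is_derive_path f x d (t : R) : differentiable f (x + t *: d) ->
  is_derive t 1 (fun s : R => f (x + s *: d)) ('D_d f (x + t *: d)).
Proof.
move=> df.
have E : (fun h : R => h^-1 *: (f (x + (h *: 1 + t) *: d) - f (x + t *: d))) =
    (fun h : R => h^-1 *: (f (h *: d + (x + t *: d)) - f (x + t *: d))).
  apply/funext => h; congr (_ *: (f _ - _)).
  by rewrite -[h *: 1]/(h * 1) mulr1 scalerDl addrCA.
have dd := diff_derivable (v := d) df.
apply: DeriveDef.
  by rewrite /derivable /= E.
by rewrite /derive /= E.
Qed.

Lemma continuous_path x d : continuous (fun s : R => x + s *: d).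
Proof.
move=> s; apply: cvgD; first exact: cvg_cst.
exact: scalel_continuous.
Qed.

(** The time [s] will depend on [x], whereas Tonelli needs a common interval. Hence the integral is
    enlarged to [[0, 1]], and the indicator of [U] discards what the rest of the segment meets
    outside [U]. *)
Lemma C1_path_le f x d (U : set (plane R)) (c s : R) : C1 f ->
  `|d.1| + `|d.2| <= c -> 0 <= s <= 1 ->
  (forall t, 0 <= t <= s -> U (x + t *: d)) -> measurable (U : set (mplane R)) ->
  ((`|f (x + s *: d) - f x|)%:E <=
    \int[leb]_(t in `[0%R, 1%R])
      (c * (enorm (grad f (x + t *: d)) * \1_U (x + t *: d)))%:E)%E.
Proof.
move=> [df cf] dc /andP[s0 s1] sU mU.
have c0 : 0 <= c by apply: le_trans dc; rewrite addr_ge0.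
have g0 t : 0 <= c * (enorm (grad f (x + t *: d)) * \1_U (x + t *: d)).
  by rewrite !mulr_ge0.
move: s0; rewrite le_eqVlt => /predU1P[<-|s0].
  rewrite scale0r addr0 subrr normr0; apply: integral_ge0 => t _.
  by rewrite lee_fin.
have cD : continuous (fun t : R => 'D_d f (x + t *: d)).
  by move=> t; exact: (continuous_comp (@continuous_path x d t) (cf d _)).
have mp : measurable_fun setT (fun t : measurableTypeR R => (x + t *: d : mplane R)).
  have -> : (fun t : measurableTypeR R => (x + t *: d : mplane R)) =
    (fun t => (x.1 + t * d.1, x.2 + t * d.2)) by [].
  by apply: measurable_fun_pair; apply: measurable_funD => //; exact: measurable_funM.
have FTC : (\int[leb]_(t in `[0%R, s]) ('D_d f (x + t *: d))%:E =
    (f (x + s *: d))%:E - (f x)%:E)%E.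
  rewrite -[in RHS](addr0 x) -[in X in (_ - X)%E](scale0r d).
  rewrite (@continuous_FTC2 _ _ (fun t : R => f (x + t *: d)) 0 s)//.
  - by rewrite addr0.
  - exact: continuous_subspaceT.
  - have cpath : continuous (fun t : R => f (x + t *: d)).
      move=> t; apply: (continuous_comp (@continuous_path x d t)).
      exact: differentiable_continuous.
    split.
    + by move=> t _; have [] := is_derive_path (df (x + t *: d)).
    + exact/cvg_at_right_filter/cpath.
    + exact/cvg_at_left_filter/cpath.
  - move=> t _; rewrite derive1E.
    by have [_ ->] := is_derive_path (df (x + t *: d)).
rewrite -abse_EFin EFinB -FTC.
have mD : measurable_fun (`[0%R, s] : set (measurableTypeR R))
    (fun t => 'D_d f (x + t *: d)).
  by apply: measurable_funTS; exact: continuous_measurable_fun.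
apply: (le_trans (le_abse_integral _ _ _)) => //; first exact/measurable_EFinP.
have mg : measurable_fun setT
    (fun t : measurableTypeR R => c * (enorm (grad f (x + t *: d)) * \1_U (x + t *: d))).
  apply: measurable_funM => //; apply: measurable_funM.
    exact: (measurableT_comp (measurable_enorm_grad (conj df cf)) mp).
  by apply: (measurableT_comp _ mp); exact: measurable_indic.
apply: (@le_trans _ _ (\int[leb]_(t in `[0%R, s])
      (c * (enorm (grad f (x + t *: d)) * \1_U (x + t *: d)))%:E)%E).
  apply: ge0_le_integral => //.
  - by apply/measurable_EFinP; exact: measurableT_comp.
  - by apply/measurable_EFinP; exact: measurable_funTS.
  - move=> t; rewrite /= in_itv/= => /sU Ut; rewrite lee_fin indicE mem_set// mulr1.
    by apply: (le_trans (norm_derive_le _ (df _))); rewrite ler_wpM2r.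
apply: ge0_subset_integral => //.
- by apply/measurable_EFinP; exact: measurable_funTS.
- by move=> t _; rewrite lee_fin.
- by move=> t /=; rewrite !in_itv/= => /andP[-> /le_trans]; apply.
Qed.

End C1_theory.

(** * Modular estimates along a fixed direction *)

Section moves.
Context {R : realType} (p : R).
Hypothesis hp : 1 < p < 2.
Local Notation mu := (@leb2 R).
Local Notation leb := (@lebesgue_measure R).
Implicit Types (f : plane R -> R) (x d : plane R) (A U : set (plane R)).

(** The factor [c] comes out of the modular as [c ^+ 2], and the indicator inside it becomes a
    restriction to [U] because [shifted_power] vanishes at [0]. *)
Lemma integral_shifted_power_transport f A U (F : plane R -> R) d (c b : R) :
  C1 f -> measurable (A : set (mplane R)) -> measurable (U : set (mplane R)) ->
  measurable_fun (A : set (mplane R)) F -> 1 <= c -> 0 <= b ->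
  (forall x, A x -> ((`|F x|)%:E <= \int[leb]_(t in `[0%R, 1%R])
    (c * (enorm (grad f (x + t *: d)) * \1_U (x + t *: d)))%:E)%E) ->
  (\int[mu]_(x in A) (shifted_power p `|F x| b)%:E <=
   (c ^+ 2)%:E * \int[mu]_(x in U) (shifted_power p (enorm (grad f x)) b)%:E)%E.
Proof.
move=> Cf mA mU mF c1 b0 hF; have c0 : 0 <= c by lra.
pose g x := c * (enorm (grad f x) * \1_U x).
have mG := measurable_enorm_grad Cf.
have mg : measurable_fun (setT : set (mplane R)) g.
  by apply: measurable_funM => //; exact: measurable_funM.
have g0 x : 0 <= g x by rewrite !mulr_ge0.
apply: (le_trans (shifted_power_transport hp mA mF mg g0 b0 hF)).
have mpsi : measurable_fun (setT : set (mplane R))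
    (fun x => shifted_power p (enorm (grad f x)) b).
  exact: (@measurable_shifted_power R p _ (mplane R)).
rewrite [X in (_ * X)%E]integral_mkcond.
rewrite -ge0_integralZl_EFin//; last 3 first.
- by move=> x _; rewrite patchE; case: ifP => // _; rewrite lee_fin.
- apply/(measurable_restrictT _ _).1 => //.
  by apply/measurable_EFinP; exact: measurable_funTS.
- exact: sqr_ge0.
apply: ge0_le_integral => //.
- by move=> x _; rewrite lee_fin.
- by apply/measurable_EFinP; exact: (@measurable_shifted_power R p _ (mplane R)).
- apply: emeasurable_funM => //; apply/(measurable_restrictT _ _).1 => //.
  by apply/measurable_EFinP; exact: measurable_funTS.
move=> x _; rewrite patchE /g indicE; case: ifP => xU.
  by rewrite mulr1 -EFinM lee_fin shifted_powerM_le.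
by rewrite !mulr0 shifted_power0 mule0.
Qed.

Lemma integral_shifted_power_exit f A U d (c b : R) :
  C1 f -> measurable (A : set (mplane R)) -> measurable (U : set (mplane R)) ->
  1 <= c -> `|d.1| + `|d.2| <= c -> 0 <= b ->
  (forall x, A x -> exists2 s : R, 0 <= s <= 1 & f (x + s *: d) = 0 /\
     forall t, 0 <= t <= s -> U (x + t *: d)) ->
  (\int[mu]_(x in A) (shifted_power p `|f x| b)%:E <=
   (c ^+ 2)%:E * \int[mu]_(x in U) (shifted_power p (enorm (grad f x)) b)%:E)%E.
Proof.
move=> Cf mA mU c1 dc b0 hA.
apply: (@integral_shifted_power_transport _ _ _ _ d) => //.
  by apply: measurable_funTS; exact: C1_measurable.
move=> x /hA[s s01 [fs sU]]; have := C1_path_le Cf dc s01 sU mU.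
by rewrite fs sub0r normrN.
Qed.

Lemma integral_shifted_power_shift f A U d (c b : R) :
  C1 f -> measurable (A : set (mplane R)) -> measurable (U : set (mplane R)) ->
  1 <= c -> `|d.1| + `|d.2| <= c -> 0 <= b ->
  (forall x t, A x -> 0 <= t <= 1 -> U (x + t *: d)) ->
  (\int[mu]_(x in A) (shifted_power p `|f (x + d) - f x| b)%:E <=
   (c ^+ 2)%:E * \int[mu]_(x in U) (shifted_power p (enorm (grad f x)) b)%:E)%E.
Proof.
move=> Cf mA mU c1 dc b0 hA.
apply: (@integral_shifted_power_transport _ _ _ (fun x => f (x + d) - f x) d) => //.
  apply: measurable_funTS; apply: measurable_funB; last exact: C1_measurable.
  exact: (measurableT_comp (C1_measurable Cf) (measurable_plane_shift d)).
move=> x Ax; have := @C1_path_le R f x d U c 1 Cf dc.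
by rewrite scale1r; apply=> //; rewrite ?ler01 ?lexx// => t t01; exact: hA.
Qed.

End moves.

(** * Convex sets and triangles *)

Section convexity.
Context {R : realType}.
Local Notation mu := (@leb2 R).
Implicit Types (x y c : plane R) (K : set (plane R)).

Definition convex K := forall x y t, K x -> K y -> 0 <= t <= 1 ->
  K ((1 - t) *: x + t *: y).

Lemma plane_ballP x (r : R) y :
  ball x r y <-> `|x.1 - y.1| < r /\ `|x.2 - y.2| < r.
Proof. by []. Qed.

(** The ball on the left is the image of [ball c r] under the homothety of centre [x] and ratio
    [t]. *)
Lemma convex_interior_contraction K c x (r t : R) : convex K -> ball c r `<=` K ->
  K x -> 0 < t <= 1 -> ball ((1 - t) *: x + t *: c) (t * r) `<=` K.
Proof.
move=> cK cr Kx /andP[t0 t1] y /plane_ballP[/= y1 y2].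
have tn : t != 0 by rewrite gt_eqF.
have -> : y = (1 - t) *: x + t *: (t^-1 *: (y - (1 - t) *: x)).
  by rewrite scalerA divff// scale1r addrC subrK.
apply: cK => //; last by rewrite ltW.
apply: cr; apply/plane_ballP.
have aux (a b d : R) : `|(1 - t) * a + t * b - d| < t * r ->
    `|b - t^-1 * (d - (1 - t) * a)| < r.
  have -> : b - t^-1 * (d - (1 - t) * a) = t^-1 * ((1 - t) * a + t * b - d) by field.
  by rewrite normrM gtr0_norm ?invr_gt0// ltr_pdivrMl.
by split; exact: aux.
Qed.

Lemma convex_interior_segment K c x (t : R) : convex K -> K° c -> K x ->
  0 < t <= 1 -> K° ((1 - t) *: x + t *: c).
Proof.
move=> cK /nbhs_ballP[r /= r0 cr] Kx t01.
apply/nbhs_ballP; exists (t * r); last exact: convex_interior_contraction.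
by case/andP: t01 => t0 _; rewrite /= mulr_gt0.
Qed.

Lemma continuous_segment x c : continuous (fun t : R => (1 - t) *: x + t *: c).
Proof.
have -> : (fun t : R => (1 - t) *: x + t *: c) = (fun t => x + t *: (c - x)).
  by apply/funext => t; rewrite scalerBl scale1r scalerBr addrAC addrA.
exact: continuous_path.
Qed.

(** An arbitrarily small step from [x] towards an interior point already lands in the interior. *)
Lemma convex_subset_closure_interior K : convex K -> K° !=set0 ->
  K `<=` closure K°.
Proof.
move=> cK [c Kc] x Kx B Bx.
have := @continuous_segment x c 0; rewrite /continuous_at subr0 scale1r scale0r addr0.
move=> /(_ _ Bx) /nbhs_ballP[e /= e0 eB].
pose t := Num.min (e / 2) 1.
have t0 : 0 < t by rewrite lt_min ltr01 divr_gt0.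
have te : t < e by rewrite /t gt_min; apply/orP; left; rewrite ltr_pdivrMr// ltr_pMr// ltr1n.
have t1 : t <= 1 by rewrite /t ge_min lexx orbT.
exists ((1 - t) *: x + t *: c); split.
  by apply: convex_interior_segment => //; rewrite t0.
by apply: eB; rewrite /ball/= sub0r normrN gtr0_norm.
Qed.

Lemma convex_connected K : convex K -> connected K.
Proof.
move=> cK; have [->|/set0P[x Kx]] := eqVneq K set0; first exact: connected0.
have -> : K = \bigcup_(y in K) ((fun t : R => (1 - t) *: x + t *: y) @` `[0, 1]).
  apply/seteqP; split => [y Ky|y [z Kz] [t]].
    exists y => //; exists 1; first by rewrite /= in_itv/= ler01 lexx.
    by rewrite subrr scale0r scale1r add0r.
  by rewrite /= in_itv/= => t01 <-; exact: cK.
apply: bigcup_connected.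
  exists x => y Ky; exists 0; first by rewrite /= in_itv/= lexx ler01.
  by rewrite subr0 scale1r scale0r addr0.
move=> y Ky; apply: connected_continuous_connected.
  exact: segment_connected.
exact/continuous_subspaceT/continuous_segment.
Qed.

Lemma interior_convex K : convex K -> convex K°.
Proof.
move=> cK x y t Kx Ky /andP[]; rewrite le_eqVlt => /predU1P[<- _|t0 t1].
  by rewrite subr0 scale1r scale0r addr0.
by apply: convex_interior_segment => //; [exact: interior_subset|rewrite t0].
Qed.

End convexity.

Section triangles.
Context {R : realType}.
Local Notation mu := (@leb2 R).
Implicit Types (a b c x y : plane R) (K : set (plane R)).

(* Twice the signed area of the triangle [a b x]; the barycentric coordinate of
   [x] at [c] is [orient a b x / orient a b c]. *)
Definition orient a b x : R :=
  (b.1 - a.1) * (x.2 - a.2) - (b.2 - a.2) * (x.1 - a.1).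

Lemma orient_cycle a b c : orient b c a = orient a b c.
Proof. by rewrite /orient; ring. Qed.

Lemma continuous_orient a b : continuous (orient a b).
Proof.
move=> x; apply: cvgB; apply: cvgM; do ?[exact: cvg_cst].
  by apply: cvgB; [exact: cvg_snd|exact: cvg_cst].
by apply: cvgB; [exact: cvg_fst|exact: cvg_cst].
Qed.

Lemma orient_neq a b c : orient a b c != 0 -> a != b.
Proof. by apply: contraNneq => ->; rewrite /orient !subrr !mul0r subrr. Qed.

(** The three quotients are the barycentric coordinates of [x]; dividing by [orient a b c] makes
    their signs independent of the orientation. *)
Lemma triangleP a b c x : noncollinear a b c -> triangle a b c x <->
  [/\ 0 <= orient b c x / orient a b c, 0 <= orient c a x / orient a b c &
      0 <= orient a b x / orient a b c].
Proof.
rewrite /noncollinear -/(orient a b c) => D0; split.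
  move=> [s [t [u [s0 t0 u0 stu ->]]]].
  have sE : s = 1 - t - u by rewrite -stu; ring.
  have e1 : orient b c (s *: a + t *: b + u *: c) = s * orient a b c.
    by rewrite /orient /= -![_ *: _]/(_ * _) sE; ring.
  have e2 : orient c a (s *: a + t *: b + u *: c) = t * orient a b c.
    by rewrite /orient /= -![_ *: _]/(_ * _) sE; ring.
  have e3 : orient a b (s *: a + t *: b + u *: c) = u * orient a b c.
    by rewrite /orient /= -![_ *: _]/(_ * _) sE; ring.
  by rewrite e1 e2 e3 !mulfK.
move=> [h1 h2 h3].
exists (orient b c x / orient a b c), (orient c a x / orient a b c),
  (orient a b x / orient a b c); split => //.
  rewrite -!mulrDl; have -> : orient b c x + orient c a x + orient a b x = orient a b c.
    by rewrite /orient; ring.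
  by rewrite divff.
move: D0; case: x {h1 h2 h3} => x1 x2 D0; congr pair => /=; rewrite -![_ *: _]/(_ * _).
  by rewrite /orient/= in D0 *; field.
by rewrite /orient/= in D0 *; field.
Qed.

Lemma triangle_convex a b c : convex (triangle a b c).
Proof.
move=> _ _ t [s1 [t1 [u1 [s10 t10 u10 e1 ->]]]] [s2 [t2 [u2 [s20 t20 u20 e2 ->]]]].
move=> /andP[t0 tl1]; have t'0 : 0 <= 1 - t by rewrite subr_ge0.
exists ((1 - t) * s1 + t * s2), ((1 - t) * t1 + t * t2), ((1 - t) * u1 + t * u2).
split; rewrite ?addr_ge0 ?mulr_ge0//.
  have -> : (1 - t) * s1 + t * s2 + ((1 - t) * t1 + t * t2) +
    ((1 - t) * u1 + t * u2) = (1 - t) * (s1 + t1 + u1) + t * (s2 + t2 + u2) by ring.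
  by rewrite e1 e2; ring.
by congr pair => /=; rewrite -![_ *: _]/(_ * _); ring.
Qed.

Lemma triangle_closed a b c : noncollinear a b c -> closed (triangle a b c).
Proof.
move=> abc; have -> : triangle a b c =
    ((fun x => orient b c x / orient a b c) @^-1` `[0, +oo[) `&`
    (((fun x => orient c a x / orient a b c) @^-1` `[0, +oo[) `&`
     ((fun x => orient a b x / orient a b c) @^-1` `[0, +oo[)).
  apply/seteqP; split => x; rewrite /= !in_itv/= !andbT.
    by move/(triangleP x abc) => [].
  by move=> [? [? ?]]; apply/(triangleP x abc).
have cl (u v : plane R) : closed ((fun x => orient u v x / orient a b c) @^-1` `[0, +oo[).
  apply: closed_comp => [x _|]; last exact: interval_closed.
  by apply: cvgM; [exact: continuous_orient|exact: cvg_cst].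
by apply: closedI => //; exact: closedI.
Qed.

Lemma triangle_compact a b c : noncollinear a b c -> compact (triangle a b c).
Proof.
move=> abc.
pose M1 := `|a.1| + `|b.1| + `|c.1|; pose M2 := `|a.2| + `|b.2| + `|c.2|.
have cB := compact_setX (@segment_compact R (- M1) M1) (@segment_compact R (- M2) M2).
apply: (subclosed_compact (triangle_closed abc) cB).
move=> _ [s [t [u [s0 t0 u0 stu ->]]]].
have aux (y1 y2 y3 : R) : `|s * y1 + t * y2 + u * y3| <= `|y1| + `|y2| + `|y3|.
  apply: (le_trans (ler_normD _ _)); apply: lerD.
    apply: (le_trans (ler_normD _ _)); apply: lerD.
      by rewrite normrM ler_piMl// ger0_norm//; lra.
    by rewrite normrM ler_piMl// ger0_norm//; lra.
  by rewrite normrM ler_piMl// ger0_norm//; lra.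
by split; rewrite /= in_itv/= -ler_norml; exact: aux.
Qed.

Lemma triangle_interior a b c x : noncollinear a b c ->
  0 < orient b c x / orient a b c -> 0 < orient c a x / orient a b c ->
  0 < orient a b x / orient a b c -> (triangle a b c)° x.
Proof.
move=> abc h1 h2 h3.
have op (u v : plane R) : 0 < orient u v x / orient a b c ->
    \forall y \near x, 0 < orient u v y / orient a b c.
  move=> uv; have cf : (fun y => orient u v y / orient a b c) @ x --> orient u v x / orient a b c.
    by apply: cvgM; [exact: continuous_orient|exact: cvg_cst].
  exact: cvgr_gt cf _ uv.
near=> y; apply/triangleP => //; split; apply/ltW; near: y; exact: op.
Unshelve. all: by end_near.
Qed.

Lemma triangle_interior_neq0 a b c : noncollinear a b c ->
  (triangle a b c)° !=set0.
Proof.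
move=> abc; exists (3^-1 *: a + 3^-1 *: b + 3^-1 *: c).
have := abc; rewrite /noncollinear -/(orient a b c) => D0.
apply: triangle_interior => //.
- have -> : orient b c (3^-1 *: a + 3^-1 *: b + 3^-1 *: c) = 3^-1 * orient a b c.
    by rewrite /orient /= -![_ *: _]/(_ * _); field.
  by rewrite mulfK// invr_gt0.
- have -> : orient c a (3^-1 *: a + 3^-1 *: b + 3^-1 *: c) = 3^-1 * orient a b c.
    by rewrite /orient /= -![_ *: _]/(_ * _); field.
  by rewrite mulfK// invr_gt0.
- have -> : orient a b (3^-1 *: a + 3^-1 *: b + 3^-1 *: c) = 3^-1 * orient a b c.
    by rewrite /orient /= -![_ *: _]/(_ * _); field.
  by rewrite mulfK// invr_gt0.
Qed.

Lemma leb2_orient a b : a != b -> mu [set x | orient a b x = 0] = 0%E.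
Proof.
move=> ab; have -> : [set x | orient a b x = 0] =
  [set x | - (b.2 - a.2) * x.1 + (b.1 - a.1) * x.2 =
           (b.1 - a.1) * a.2 - (b.2 - a.2) * a.1].
  by apply/seteqP; split => x; rewrite /orient /=; lra.
apply: leb2_line; rewrite oppr_eq0 !subr_eq0 -negb_and.
by apply: contraNN ab => /andP[/eqP e2 /eqP e1]; apply/eqP; case: a b e1 e2 => ? ? [? ?] /= -> ->.
Qed.

Lemma measurable_orient0 a b :
  measurable ([set x | orient a b x = 0] : set (mplane R)).
Proof.
apply: measurable_plane_closed.
have -> : [set x | orient a b x = 0] = orient a b @^-1` `[0, 0] by rewrite set_itv1.
by apply: closed_comp => [x _|]; [exact: continuous_orient|exact: interval_closed].
Qed.

(** A point of the triangle off the three side lines has positive barycentric coordinates, hence is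
    interior. *)
Lemma leb2_triangle_boundary a b c : noncollinear a b c ->
  mu (triangle a b c `\` (triangle a b c)°) = 0%E.
Proof.
move=> abc; have D0 : orient a b c != 0 := abc.
have mK : measurable (triangle a b c : set (mplane R)).
  by apply: measurable_plane_closed; exact: triangle_closed.
have mI : measurable ((triangle a b c)° : set (mplane R)).
  by apply: measurable_plane_open; exact: open_interior.
pose N u v := [set x : plane R | orient u v x = 0].
have N0 u v : u != v -> mu.-negligible (N u v).
  by move=> uv; exists (N u v); split => //; [exact: measurable_orient0|exact: leb2_orient].
have ab : a != b by exact: orient_neq D0.
have bc : b != c by apply: (@orient_neq b c a); rewrite orient_cycle.
have ca : c != a by apply: (@orient_neq c a b); rewrite (orient_cycle b) orient_cycle.
apply: measure_negligible; first exact: measurableD.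
have NN : mu.-negligible (N a b `|` (N b c `|` N c a)).
  apply: negligibleU; first exact: N0.
  by apply: negligibleU; exact: N0.
apply: (negligibleS _ NN).
move=> x [/(triangleP x abc)[h1 h2 h3]] nI; apply: contrapT => h; apply: nI.
have pos u v : ~ N u v x -> 0 <= orient u v x / orient a b c ->
    0 < orient u v x / orient a b c.
  move=> Nx; rewrite le_eqVlt => /predU1P[/esym/eqP|//].
  by rewrite mulf_eq0 invr_eq0 (negbTE D0) orbF => /eqP.
by apply: triangle_interior => //; apply: pos => // Nx; apply: h; [right; left|right; right|left].
Qed.

End triangles.

(** * Sets on which the Poincare inequality holds *)

(** What the zero extension of a test function satisfies. The condition on the gradient lets
    energies over the whole plane be cut down to [Omega]. *)
Definition admissible (R : realType) (Omega : set (plane R)) (f : plane R -> R) :=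
  [/\ C1 f, forall x, ~ Omega x -> f x = 0 & forall x, ~ Omega x -> grad f x = 0].

Section controlled.
Context {R : realType} (p : R).
Hypothesis hp : 1 < p < 2.
Variable Omega : set (plane R).
Local Notation mu := (@leb2 R).
Implicit Types (f : plane R -> R) (x d : plane R) (A B K : set (plane R)).

Local Notation energy A g b :=
  (\int[mu]_(x in A) (shifted_power p (g x) b)%:E)%E.

Lemma measurable_shifted_power_norm f A (b : R) : C1 f ->
  measurable_fun (A : set (mplane R)) (fun x => (shifted_power p `|f x| b)%:E).
Proof.
move=> Cf; apply/measurable_EFinP; apply: (@measurable_shifted_power R p _ (mplane R)) => //.
by apply: measurable_funTS; apply: measurableT_comp => //; exact: C1_measurable.
Qed.

Lemma measurable_shifted_power_grad f A (b : R) : C1 f ->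
  measurable_fun (A : set (mplane R))
    (fun x => (shifted_power p (enorm (grad f x)) b)%:E).
Proof.
move=> Cf; apply/measurable_EFinP; apply: (@measurable_shifted_power R p _ (mplane R)) => //.
by apply: measurable_funTS; exact: measurable_enorm_grad.
Qed.

Lemma ge0_integral_setU_le (A B : set (mplane R)) (h : mplane R -> \bar R) :
  measurable A -> measurable B -> measurable_fun setT h -> (forall x, 0 <= h x)%E ->
  (\int[mu]_(x in A `|` B) h x <= \int[mu]_(x in A) h x + \int[mu]_(x in B) h x)%E.
Proof.
move=> mA mB mh h0.
have -> : A `|` B = A `|` (B `\` A) by rewrite setDE setUIr setUv setIT.
rewrite ge0_integral_setU//; last 3 first.
- exact: measurableD.
- exact: measurable_funTS.
- by apply/disj_setPS => x [Ax []].
apply: leeD => //; apply: ge0_subset_integral => //.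
- exact: measurableD.
- exact: measurable_funTS.
Qed.

Variable U : set (plane R).
Hypothesis mU : measurable (U : set (mplane R)).

Definition controlled A := exists2 C : R, 0 <= C & forall f, admissible Omega f ->
  (\int[mu]_(x in A) (shifted_power p `|f x| 0)%:E <=
   C%:E * energy U (fun x => enorm (grad f x)) 0)%E.

Lemma controlled_subset A B :
  measurable (A : set (mplane R)) -> measurable (B : set (mplane R)) ->
  A `<=` B -> controlled B -> controlled A.
Proof.
move=> mA mB AB [C C0 hC]; exists C => // f af; apply: le_trans (hC f af).
case: af => Cf _ _; apply: ge0_subset_integral => //.
  exact: measurable_shifted_power_norm.
by move=> x _; rewrite lee_fin.
Qed.

Lemma controlled0 : controlled set0.
Proof. by exists 0 => // f _; rewrite integral_set0 mul0e. Qed.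

Lemma controlledU A B :
  measurable (A : set (mplane R)) -> measurable (B : set (mplane R)) ->
  controlled A -> controlled B -> controlled (A `|` B).
Proof.
move=> mA mB [C C0 hC] [D D0 hD]; exists (C + D); first exact: addr_ge0.
move=> f af; have := leeD (hC f af) (hD f af).
rewrite -ge0_muleDl ?lee_fin// -EFinD; apply: le_trans.
case: af => Cf _ _; apply: ge0_integral_setU_le => //.
  exact: measurable_shifted_power_norm.
by move=> x; rewrite lee_fin.
Qed.

Lemma controlled_bigcup_seq (I : eqType) (s : seq I) (A : I -> set (plane R)) :
  (forall i, i \in s -> measurable (A i : set (mplane R))) ->
  (forall i, i \in s -> controlled (A i)) ->
  measurable (\bigcup_(i in [set` s]) A i : set (mplane R)) /\
  controlled (\bigcup_(i in [set` s]) A i).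
Proof.
elim: s => [_ _|i s IH mA hA].
  by rewrite set_nil bigcup_set0; split=> //; exact: controlled0.
have [||mS hS] := IH.
- by move=> j js; apply: mA; rewrite inE js orbT.
- by move=> j js; apply: hA; rewrite inE js orbT.
have -> : \bigcup_(i in [set` i :: s]) A i = A i `|` \bigcup_(i in [set` s]) A i.
  apply/seteqP; split => x.
    by move=> [j /=]; rewrite inE => /predU1P[->|js] jx; [left|right; exists j].
  move=> [ix|[j js jx]]; first by exists i => //=; rewrite inE eqxx.
  by exists j => //=; rewrite inE [j \in s]js orbT.
have mi : measurable (A i : set (mplane R)) by apply: mA; rewrite inE eqxx.
split; first exact: measurableU.
by apply: controlledU => //; apply: hA; rewrite inE eqxx.
Qed.

Lemma controlled_exit A d : measurable (A : set (mplane R)) ->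
  (forall x, A x -> exists2 s : R, 0 <= s <= 1 & ~ Omega (x + s *: d) /\
     forall t, 0 <= t <= s -> U (x + t *: d)) ->
  controlled A.
Proof.
move=> mA hA; pose c := Num.max 1 (`|d.1| + `|d.2|).
exists (c ^+ 2); first exact: sqr_ge0.
move=> f [Cf f0 _]; apply: (@integral_shifted_power_exit R p hp f A U d) => //.
- by rewrite le_max lexx.
- by rewrite le_max lexx orbT.
- by move=> x /hA[s s01 [ns sU]]; exists s => //; split=> //; exact: f0.
Qed.

(** Writes [f x] as [f (x + d)] minus an increment. The first is controlled on [B] by translation
    invariance, the second by the energy along the segments in [U], and [4] is the price of adding
    them. *)
Lemma controlled_shift A B d :
  measurable (A : set (mplane R)) -> measurable (B : set (mplane R)) ->
  (forall x t, A x -> 0 <= t <= 1 -> U (x + t *: d)) ->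
  (forall x, A x -> B (x + d)) -> controlled B -> controlled A.
Proof.
move=> mA mB AU AB [C C0 hC]; pose c := Num.max 1 (`|d.1| + `|d.2|).
exists (4 * (C + c ^+ 2)); first by rewrite mulr_ge0 ?addr_ge0 ?sqr_ge0.
move=> f af; have [Cf f0 _] := af.
have mfd : measurable_fun (setT : set (mplane R)) (fun x => f (x + d)).
  exact: (measurableT_comp (C1_measurable Cf) (measurable_plane_shift d)).
have mpsi (g : plane R -> R) (D : set (mplane R)) :
    measurable_fun (setT : set (mplane R)) g ->
    measurable_fun D (fun x => (shifted_power p `|g x| 0)%:E).
  move=> mg; apply/measurable_EFinP; apply: (@measurable_shifted_power R p _ (mplane R)) => //.
  by apply: measurable_funTS; exact: measurableT_comp.
have mfdf : measurable_fun (setT : set (mplane R)) (fun x => f (x + d) - f x).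
  by apply: measurable_funB => //; exact: C1_measurable.
have h1 : (\int[mu]_(x in A) (shifted_power p `|f (x + d)%R| 0)%:E <=
    C%:E * energy U (fun x => enorm (grad f x)) 0)%E.
  apply: le_trans (hC f af).
  rewrite -(@ge0_integral_leb2_shift R d B (fun x => (shifted_power p `|f x| 0)%:E))//.
  - apply: ge0_subset_integral => //.
    + rewrite -[X in measurable X]setTI; exact: measurable_plane_shift.
    + exact: (mpsi (fun x => f (x + d))).
    + by move=> x _; rewrite lee_fin.
  - exact: measurable_shifted_power_norm.
  - by move=> x; rewrite lee_fin.
have h2 : (\int[mu]_(x in A) (shifted_power p `|f (x + d)%R - f x| 0)%:E <=
    (c ^+ 2)%:E * energy U (fun x => enorm (grad f x)) 0)%E.
  apply: (@integral_shifted_power_shift R p hp f A U d) => //.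
  - by rewrite le_max lexx.
  - by rewrite le_max lexx orbT.
have four0 : (0 <= 4%:E :> \bar R)%E by rewrite lee_fin.
have := lee_wpmul2l four0 (leeD h1 h2).
rewrite -ge0_muleDl ?lee_fin ?sqr_ge0// -EFinD muleA -EFinM; apply: le_trans.
rewrite -ge0_integralD//; last 4 first.
- by move=> x _; rewrite lee_fin.
- exact: (mpsi (fun x => f (x + d))).
- by move=> x _; rewrite lee_fin.
- exact: (mpsi (fun x => f (x + d) - f x)).
rewrite -ge0_integralZl_EFin//; last 2 first.
- by move=> x _; rewrite -EFinD lee_fin addr_ge0.
- by apply: emeasurable_funD;
    [exact: (mpsi (fun x => f (x + d)))|exact: (mpsi (fun x => f (x + d) - f x))].
apply: ge0_le_integral => //.
- by move=> x _; rewrite lee_fin.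
- exact: measurable_shifted_power_norm.
- apply: emeasurable_funM => //.
  by apply: emeasurable_funD;
    [exact: (mpsi (fun x => f (x + d)))|exact: (mpsi (fun x => f (x + d) - f x))].
move=> x _; rewrite -EFinD -EFinM lee_fin.
apply: le_trans (shifted_powerD_le hp _ _ _) => //.
apply: ler_shifted_powerl => //.
by rewrite -{1}[f x](subKr (f (x + d))); exact: ler_normB.
Qed.

(* By convexity, the translates of [ball y r `&` K] towards [ball x r] stay in [K]. *)
Lemma controlled_fill K x (r : R) : convex K -> compact K -> closed K -> K `<=` U ->
  0 < r -> ball x r `<=` K -> controlled (ball x r) -> controlled K.
Proof.
move=> cvK cK clK KU r0 xK cB.
have mK := measurable_plane_closed clK.
pose T : ptopologicalType := HB.pack (R * R)%type (isPointed.Build (R * R)%type 0).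
have : @cover_compact T K by have <- := congr1 (fun F => F K) (@compact_cover T).
move=> /(_ _ K (fun y => ball y r)); case.
- by move=> y _; exact: ball_open.
- by move=> y Ky; exists y => //; exact: ballxx.
move=> D DK KD.
have [||mS hS] := @controlled_bigcup_seq _ (finmap.enum_fset D) (fun y => ball y r `&` K).
- by move=> y _; apply: measurableI => //; exact: measurable_plane_ball.
- move=> y /DK /set_mem Ky.
  apply: (@controlled_shift _ (ball x r) (x - y)) => //.
  + by apply: measurableI => //; exact: measurable_plane_ball.
  + exact: measurable_plane_ball.
  + move=> z t [/plane_ballP[z1 z2] Kz] t01; apply: KU.
    have -> : z + t *: (x - y) = (1 - t) *: z + t *: (z + (x - y)).
      by congr pair => /=; rewrite -![_ *: _]/(_ * _); ring.
    apply: cvK => //; apply: xK; apply/plane_ballP => /=; split.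
      by have -> : x.1 - (z.1 + (x.1 - y.1)) = y.1 - z.1 by ring.
    by have -> : x.2 - (z.2 + (x.2 - y.2)) = y.2 - z.2 by ring.
  + move=> z [/plane_ballP[z1 z2] Kz]; apply/plane_ballP => /=; split.
      by have -> : x.1 - (z.1 + (x.1 - y.1)) = y.1 - z.1 by ring.
    by have -> : x.2 - (z.2 + (x.2 - y.2)) = y.2 - z.2 by ring.
apply: (controlled_subset _ _ _ hS) => // z Kz.
by have [y yD yz] := KD z Kz; exists y.
Qed.

End controlled.

(** * Lipschitz domains and propagation by connectedness *)

Section lipschitz_domain.
Context {R : realType}.
Implicit Types (x y z : plane R) (Omega : set (plane R)).

Lemma boundary_open_notin Omega x : open Omega -> boundary Omega x -> ~ Omega x.
Proof. by move=> oO [_]; rewrite (interior_id _).1. Qed.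

Lemma lipschitz_continuous (g : R -> R) : [lipschitz g s | s in [set: R]] ->
  continuous g.
Proof.
move=> [M [_ /(_ (`|M| + 1))]]; rewrite (le_lt_trans (ler_norm M)) ?ltrDl// => /(_ isT) hg.
move=> s; apply/cvgrPdist_lt => e e0.
have k0 : 0 < `|M| + 1 by rewrite ltr_wpDl.
near=> t; apply: (@le_lt_trans _ _ ((`|M| + 1) * `|s - t|)).
  exact: (hg (s, t)).
rewrite -ltr_pdivlMl//; near: t.
by apply: cvgr_dist_lt => //; rewrite mulr_gt0// invr_gt0.
Unshelve. all: by end_near.
Qed.

Lemma orthonormal_coordinates (e1 e2 w : plane R) :
  dot e1 e1 = 1 -> dot e2 e2 = 1 -> dot e1 e2 = 0 ->
  w = dot w e1 *: e1 + dot w e2 *: e2.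
Proof.
case: e1 e2 w => [a b] [c d] [u v]; rewrite /dot /= => ab cd abcd.
(* The determinant of the frame, equal to 1 or -1. It gives [e2 = D *: (- b, a)], so the transposed
   matrix is orthogonal too, which is what the expansion of [w] needs. *)
pose D := a * d - b * c.
have DD : D * D = 1.
  have -> : D * D = (a * a + b * b) * (c * c + d * d) - (a * c + b * d) ^+ 2.
    by rewrite /D; ring.
  by rewrite ab cd abcd; ring.
have cE : c = - (b * D).
  have -> : c = c * (a * a + b * b) - a * (a * c + b * d) by rewrite ab abcd; ring.
  by rewrite /D; ring.
have dE : d = a * D.
  have -> : d = d * (a * a + b * b) - b * (a * c + b * d) by rewrite ab abcd; ring.
  by rewrite /D; ring.
have ac : a * a + c * c = 1.
  by rewrite cE -ab -[in RHS](mulr1 (b * b)) -DD; ring.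
have bd : b * b + d * d = 1.
  by rewrite dE -ab -[in RHS](mulr1 (a * a)) -DD; ring.
have abcd' : a * b + c * d = 0.
  rewrite cE dE; have -> : a * b + - (b * D) * (a * D) = a * b * (1 - D * D) by ring.
  by rewrite DD subrr mulr0.
congr pair => /=; rewrite -![_ *: _]/(_ * _).
  have -> : (u * a + v * b) * a + (u * c + v * d) * c =
    u * (a * a + c * c) + v * (a * b + c * d) by ring.
  by rewrite ac abcd'; ring.
have -> : (u * a + v * b) * b + (u * c + v * d) * d =
  u * (a * b + c * d) + v * (b * b + d * d) by ring.
by rewrite bd abcd'; ring.
Qed.

Lemma continuous_dot z e : continuous (fun x : plane R => dot (x - z) e).
Proof.
move=> x; apply: cvgD; apply: cvgM; do ?[exact: cvg_cst].
  by apply: cvgB; [exact: cvg_fst|exact: cvg_cst].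
by apply: cvgB; [exact: cvg_snd|exact: cvg_cst].
Qed.

(* Just below a boundary point, in the direction of the local graph, there are
   exterior points. *)
Lemma lipschitz_interior_closure Omega : open Omega -> lipschitz_boundary Omega ->
  (closure Omega)° `<=` Omega.
Proof.
move=> oO lO x cx; apply: contrapT => nx.
have bx : boundary Omega x by split; [exact: interior_subset|rewrite (interior_id _).1].
have [e1 [e2 [r [h [g [[e11 e22 e12] r0 h0 lg gO]]]]]] := lO _ bx.
have cg := lipschitz_continuous lg.
(* The origin of the local coordinates is [x], which is not in [Omega]. So a point with coordinates
   [(0, - t)] is strictly below the graph, and by continuity so is a whole neighbourhood of it. *)
have g0 : 0 <= g 0.
  rewrite leNgt; apply/negP => g0; apply: nx.
  have := gO 0 0; rewrite !normr0 !scale0r !addr0 => /(_ r0 h0)[_]; exact.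
have cy := @continuous_path R x (- e2) 0.
have [t [t0 th clt]] : exists t : R, [/\ 0 < t, t < h & closure Omega (x + t *: - e2)].
  have : nbhs (x + 0 *: - e2) (closure Omega) by rewrite scale0r addr0.
  move=> /cy /nbhs_ballP[e /= e0 eO].
  pose t := Num.min (e / 2) (h / 2).
  have t0 : 0 < t by rewrite lt_min !divr_gt0.
  exists t; split => //.
    by rewrite gt_min; apply/orP; right; rewrite ltr_pdivrMr// ltr_pMr// ltr1n.
  apply: eO; rewrite /ball/= sub0r normrN gtr0_norm//.
  by rewrite gt_min; apply/orP; left; rewrite ltr_pdivrMr// ltr_pMr// ltr1n.
set y := x + t *: - e2 in clt.
have ys : dot (y - x) e1 = 0.
  rewrite /y addrAC subrr add0r /dot/= -![_ *: _]/(_ * _).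
  by move: e12; rewrite /dot => e12; rewrite -[RHS](mulr0 (- t)) -e12; ring.
have yt : dot (y - x) e2 = - t.
  rewrite /y addrAC subrr add0r /dot/= -![_ *: _]/(_ * _).
  by move: e22; rewrite /dot => e22; rewrite -[RHS]mulr1 -e22; ring.
have cs := @continuous_dot x e1 y; have ct := @continuous_dot x e2 y.
have : \forall w \near y, ~ Omega w.
  near=> w.
  have ws : `|dot (w - x) e1| < r.
    by near: w; apply: (cvgr_norm_lt _ cs); rewrite ys normr0.
  have wt : `|dot (w - x) e2| < h.
    by near: w; apply: (cvgr_norm_lt _ ct); rewrite yt normrN gtr0_norm.
  have wg : dot (w - x) e2 < g (dot (w - x) e1).
    rewrite -subr_gt0; near: w.
    have c : (fun w => g (dot (w - x) e1) - dot (w - x) e2) @ y -->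
        g (dot (y - x) e1) - dot (y - x) e2.
      apply: cvgB; last exact: ct.
      by apply: (continuous_comp cs); exact: cg.
    apply: (cvgr_gt _ c); rewrite ys yt; lra.
  have := (gO _ _ ws wt).1.
  rewrite -addrA -orthonormal_coordinates// addrC subrK => gw /gw.
  by move/(lt_trans wg); rewrite ltxx.
by move=> /clt[w []].
Unshelve. all: by end_near.
Qed.

End lipschitz_domain.

Section connectedness.
Context {R : realType} (p : R).
Hypothesis hp : 1 < p < 2.
Variable Omega : set (plane R).
Implicit Types (x d : plane R) (A B K S U : set (plane R)).

Lemma connected_between (T : topologicalType) (A B : set T) :
  connected A -> A `<=` B -> B `<=` closure A -> connected B.
Proof.
move=> cA AB BA P [x Px] [C oC PC] [D cD PD].
have Cx : C x by move: Px; rewrite PC => -[].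
have Bx : B x by move: Px; rewrite PC => -[].
have [y [Ay Cy]] := BA _ Bx C (open_nbhs_nbhs (conj oC Cx)).
have PA : P `&` A = A.
  apply: cA; first by exists y; split => //; rewrite PC; split => //; exact: AB.
    by exists C => //; rewrite PC setIAC; congr (_ `&` _); apply/setIidPr.
  by exists D => //; rewrite PD setIAC; congr (_ `&` _); apply/setIidPr.
have AD : A `<=` D by move=> z; rewrite -PA PD => -[[]].
have clAD : closure A `<=` D.
  by rewrite [X in _ `<=` X](closure_id D).1//; exact: closureS.
by rewrite PD; apply/setIidPl => z /BA /clAD.
Qed.

(** The centres of controlled balls form an open and relatively closed subset of [S]: a small ball
    around [y] can be translated onto a ball around a good centre near [y]. *)
Lemma controlled_region U S x0 (s0 : R) :
  measurable (U : set (mplane R)) -> open S -> connected S -> S `<=` U ->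
  0 < s0 -> ball x0 s0 `<=` S -> controlled p Omega U (ball x0 s0) ->
  forall x, S x -> exists r : R,
    [/\ 0 < r, ball x r `<=` S & controlled p Omega U (ball x r)].
Proof.
move=> mU oS cS SU s00 b0 c0.
pose good x := exists r : R,
  [/\ 0 < r, ball x r `<=` S & controlled p Omega U (ball x r)].
have sub x y (r e : R) : ball y e `<=` ball x r ->
    controlled p Omega U (ball x r) -> controlled p Omega U (ball y e).
  by apply: controlled_subset; exact: measurable_plane_ball.
have S_ball y : S y -> exists2 e : R, 0 < e & ball y e `<=` S.
  by move=> Sy; have /nbhs_ballP := open_nbhs_nbhs (conj oS Sy).
have openg : open [set x | good x].
  rewrite openE => x [r [r0 rS cr]] /=.
  apply/nbhs_ballP; exists r => //= y xy.
  have [e /= e0 eb] : nbhs_ball_ ball y (ball x r).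
    by apply/nbhs_ballP; apply: open_nbhs_nbhs; split => //; exact: ball_open.
  exists e; split; [exact: e0|exact: (subset_trans eb rS)|exact: (sub _ _ _ _ eb cr)].
have openb : open (S `&` [set x | ~ good x]).
  rewrite openE => y [Sy ny] /=.
  have [e e0 eS] := S_ball y Sy.
  have e20 : 0 < e / 2 by rewrite divr_gt0.
  apply/nbhs_ballP; exists (e / 2); first exact: e20.
  move=> x yx; split.
    by apply: eS; apply: le_ball yx; rewrite ler_pdivrMr// ler_pMr// ler1n.
  move=> [r [r0 rS cr]]; apply: ny.
  (* With [x] within [e / 2] of [y], a point within [e / 2] of [y] travels inside [ball y e], hence
     inside [S]. *)
  pose r' := Num.min r (e / 2).
  have r'0 : 0 < r' by rewrite lt_min r0.
  have r'r : r' <= r by rewrite ge_min lexx.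
  have r'e : r' <= e / 2 by rewrite ge_min lexx orbT.
  have ye : ball y r' `<=` ball y e.
    by apply: le_ball; apply: (le_trans r'e); rewrite ler_pdivrMr// ler_pMr// ler1n.
  have cr' : controlled p Omega U (ball x r') by exact: (sub _ _ _ _ (le_ball r'r) cr).
  exists r'; split; [exact: r'0|exact: (subset_trans ye eS)|].
  apply: (@controlled_shift R p hp Omega U mU (ball y r') (ball x r') (x - y)) => //.
  - exact: measurable_plane_ball.
  - exact: measurable_plane_ball.
  - move=> z t /plane_ballP[z1 z2] /andP[t0 t1]; apply: SU; apply: eS.
    move/plane_ballP: yx => [yx1 yx2].
    have aux (a b c : R) : `|a - b| < e / 2 -> `|a - c| < r' ->
        `|a - (c + t * (b - a))| < e.
      move=> h1 h2; have -> : a - (c + t * (b - a)) = (a - c) + t * (a - b) by ring.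
      apply: (le_lt_trans (ler_normD _ _)); rewrite normrM ger0_norm// [e]splitr.
      apply: ltr_leD; first exact: lt_le_trans r'e.
      by apply: le_trans (ltW h1); rewrite ler_piMl.
    by apply/plane_ballP; split; exact: aux.
  - move=> z /plane_ballP[z1 z2]; apply/plane_ballP; split => /=.
      by have -> : x.1 - (z.1 + (x.1 - y.1)) = y.1 - z.1 by ring.
    by have -> : x.2 - (z.2 + (x.2 - y.2)) = y.2 - z.2 by ring.
have : S `&` [set x | good x] = S.
  apply: cS.
  - exists x0; split; first exact/b0/ballxx.
    by exists s0.
  - by exists [set x | good x].
  - exists (~` (S `&` [set x | ~ good x])); first exact: open_closedC.
    apply/seteqP; split => x [Sx gx]; split => //; first by move=> [_].
    by apply: contrapT => ngx; apply: gx.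
by move=> SE x; rewrite -{1}SE => -[].
Qed.

(** The edge supplied by the hypothesis on flat regions belongs to some element of the mesh, perhaps
    not to one of the region. It lies in the finite union of the region's elements, though, and one
    of these must contain two of its points, since otherwise [E] would be finite. *)
Lemma pigeonhole_two_points (E : set (plane R)) (F : set (set (plane R))) :
  finite_set F -> infinite_set E -> E `<=` \bigcup_(L in F) L ->
  exists L x y, [/\ F L, x != y, E x, E y & L x /\ L y].
Proof.
move=> finF infE EF; apply: contrapT => h; apply: infE.
have -> : E = \bigcup_(L in F) (E `&` L).
  by apply/seteqP; split => [x Ex|x [L _ []]//]; have [L FL Lx] := EF x Ex; exists L.
apply: bigcup_finite => // L FL.
have [->|/set0P[x [Ex Lx]]] := eqVneq (E `&` L) set0; first exact: finite_set0.
have -> : E `&` L = [set x]; last exact: finite_set1.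
apply/seteqP; split => [y [Ey Ly]|y ->//].
apply/eqP; apply: contrapT => /negP yx; apply: h.
by exists L, y, x.
Qed.

Lemma infinite_segment (a b : plane R) : a != b -> infinite_set (segment a b).
Proof.
move=> ab fin.
pose f (n : nat) : plane R := (1 - n.+1%:R^-1) *: a + n.+1%:R^-1 *: b.
have fE n : f n = a + n.+1%:R^-1 *: (b - a).
  by rewrite /f scalerBl scale1r scalerBr addrAC addrA.
have : finite_set (f @^-1` segment a b).
  apply: finite_preimage => // m n _ _; rewrite !fE => /addrI /eqP.
  rewrite -subr_eq0 -scalerBl scaler_eq0 orbC subr_eq0 [b == a]eq_sym (negbTE ab)/=.
  by rewrite subr_eq0 => /eqP/invr_inj/eqP; rewrite eqr_nat => /eqP[].
have -> : f @^-1` segment a b = setT.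
  apply/seteqP; split => // n _; exists n.+1%:R^-1 => //.
  by rewrite invr_ge0 ler0n invf_le1// ler1n.
exact: infinite_nat.
Qed.

Lemma segment_convex (a b x y : plane R) : segment a b x -> segment a b y ->
  segment x y `<=` segment a b.
Proof.
move=> [s s01 ->] [t t01 ->] z [u /andP[u0 u1] ->].
exists ((1 - u) * s + u * t).
  move: s01 t01 => /andP[s0 s1] /andP[t0 t1].
  by apply/andP; split; nra.
by congr pair => /=; rewrite -![_ *: _]/(_ * _); ring.
Qed.

Lemma triangle_not_in_line a b c (x y : plane R) : noncollinear a b c -> x != y ->
  exists2 z, triangle a b c z & noncollinear x y z.
Proof.
move=> abc xy; apply: contrapT => h.
have on z : triangle a b c z -> orient x y z = 0.
  by move=> tz; apply/eqP; apply: contrapT => /negP nz; apply: h; exists z.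
have ha := on a; have hb := on b; have hc := on c.
have {}ha : orient x y a = 0.
  by apply: ha; exists 1, 0, 0; rewrite !scale0r !addr0 scale1r ?ler01 ?lexx; split.
have {}hb : orient x y b = 0.
  apply: hb; exists 0, 1, 0.
  by rewrite !scale0r add0r !addr0 scale1r ?ler01 ?lexx; split; rewrite ?add0r.
have {}hc : orient x y c = 0.
  by apply: hc; exists 0, 0, 1; rewrite !scale0r !add0r scale1r ?ler01 ?lexx; split.
move: abc; rewrite /noncollinear => /eqP; apply.
move: ha hb hc; rewrite /orient => ha hb hc.
set D := (X in X = 0); set P := y.1 - x.1 in ha hb hc; set Q := y.2 - x.2 in ha hb hc.
have hab : P * (b.2 - a.2) = Q * (b.1 - a.1).
  by apply/eqP; rewrite -subr_eq0 -[X in _ == X]subr0 -{1}hb -ha; apply/eqP; ring.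
have hac : P * (c.2 - a.2) = Q * (c.1 - a.1).
  by apply/eqP; rewrite -subr_eq0 -[X in _ == X]subr0 -{1}hc -ha; apply/eqP; ring.
(* Both sides [b - a] and [c - a] are parallel to [(P, Q)], so [P] and [Q] annihilate [D]. As [D] is
   nonzero, this forces [x = y]. *)
have PD : P * D = 0.
  have -> : P * D = (b.1 - a.1) * (P * (c.2 - a.2)) - (P * (b.2 - a.2)) * (c.1 - a.1).
    by rewrite /D; ring.
  by rewrite hab hac; ring.
have QD : Q * D = 0.
  have -> : Q * D = (Q * (b.1 - a.1)) * (c.2 - a.2) - (b.2 - a.2) * (Q * (c.1 - a.1)).
    by rewrite /D; ring.
  by rewrite -hab -hac; ring.
apply/eqP; apply: contraNT xy => D0; apply/eqP.
have P0 : P = 0 by apply: (mulIf D0); rewrite PD mul0r.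
have Q0 : Q = 0 by apply: (mulIf D0); rewrite QD mul0r.
move: P0 Q0; rewrite /P /Q => /eqP; rewrite subr_eq0 => /eqP P0 /eqP.
rewrite subr_eq0 => /eqP Q0.
by case: x y P0 Q0 {h ha hb hc on P Q PD QD hab hac} => ? ? [? ?] /= -> ->.
Qed.

End connectedness.

(** * Flat regions *)

Section flat_regions.
Context {R : realType} (p : R).
Hypothesis hp : 1 < p < 2.
Implicit Types (x d : plane R) (A B K S U E Omega : set (plane R)).
Implicit Types (T F : set (set (plane R))).

Definition triangular T := forall K, T K -> exists a b c, has_vertices K a b c.

Lemma triangular_convex T K : triangular T -> T K -> convex K.
Proof. by move=> tT /tT[a [b [c [_ ->]]]]; exact: triangle_convex. Qed.

Lemma triangular_closed T K : triangular T -> T K -> closed K.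
Proof. by move=> tT /tT[a [b [c [abc ->]]]]; exact: triangle_closed. Qed.

Lemma triangular_compact T K : triangular T -> T K -> compact K.
Proof. by move=> tT /tT[a [b [c [abc ->]]]]; exact: triangle_compact. Qed.

Lemma triangular_interior_neq0 T K : triangular T -> T K -> K° !=set0.
Proof. by move=> tT /tT[a [b [c [abc ->]]]]; exact: triangle_interior_neq0. Qed.

Lemma measurable_interior (A : set (plane R)) :
  measurable (A° : set (mplane R)).
Proof. by apply: measurable_plane_open; exact: open_interior. Qed.

Lemma triangular_measurable T K : triangular T -> T K ->
  measurable (K : set (mplane R)).
Proof. by move=> tT TK; apply: measurable_plane_closed; exact: triangular_closed TK. Qed.

Lemma triangular_bigcup_closed T : finite_set T -> triangular T ->
  closed (\bigcup_(K in T) K).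
Proof. by move=> fT tT; apply: closed_bigcup => // K; exact: triangular_closed. Qed.

Lemma triangle_hull K a b c : convex K -> K a -> K b -> K c -> triangle a b c `<=` K.
Proof.
move=> cK Ka Kb Kc _ [s [t [u [s0 t0 u0 stu ->]]]].
have [u1|u1] := eqVneq u 1.
  have -> : s = 0 by lra.
  have -> : t = 0 by lra.
  by rewrite u1 !scale0r !add0r scale1r.
have v0 : 1 - u != 0 by rewrite subr_eq0 eq_sym.
have v1 : 0 < 1 - u by rewrite lt_neqAle eq_sym v0/=; lra.
have sE : s = 1 - u - t by lra.
have -> : s *: a + t *: b + u *: c =
    (1 - u) *: ((1 - t / (1 - u)) *: a + (t / (1 - u)) *: b) + u *: c.
  by congr pair => /=; rewrite -![_ *: _]/(_ * _) sE; field.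
apply: (cK) => //; last by apply/andP; split; lra.
apply: cK => //; rewrite divr_ge0 ?(ltW v1)//= ler_pdivrMr//; lra.
Qed.

Lemma ball_subset_interior A x (r : R) : ball x r `<=` A -> ball x r `<=` A°.
Proof. by move=> h; rewrite -open_subsetE//; exact: ball_open. Qed.

(* The chain starts from a triangle whose base lies on the edge [E], where the
   admissible functions vanish. *)
Lemma flat_region_controlled Omega T F K0 E :
  open Omega -> finite_set T -> triangular T -> F `<=` T ->
  connected (\bigcup_(K in F) K)° -> T K0 -> edge K0 E ->
  E `<=` boundary (\bigcup_(K in F) K)° `&` boundary Omega ->
  forall K, F K -> controlled p Omega (\bigcup_(K in F) K) K.
Proof.
move=> oO fT tT FT; set U := \bigcup_(K in F) K => cS TK0.
move=> [a [b [c0 [[abc _] ->]]]] Eb K FK.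
have tF : triangular F by move=> L /FT; exact: tT.
have fF : finite_set F by exact: sub_finite_set fT.
have clU : closed U by exact: triangular_bigcup_closed.
have mU : measurable (U : set (mplane R)) by exact: measurable_plane_closed.
have KU : K `<=` U by move=> x Kx; exists K.
have ab : a != b by exact: orient_neq abc.
have EU : segment a b `<=` \bigcup_(L in F) L.
  move=> x /Eb[[clx _] _]; rewrite -/U [U](closure_id _).1//.
  by apply: closureS clx; exact: interior_subset.
have [L [q1 [q2 [FL q12 Eq1 Eq2 [Lq1 Lq2]]]]] :=
  pigeonhole_two_points fF (infinite_segment ab) EU.
have [a' [b' [c' [abc' LE]]]] := tF _ FL.
have [z Lz nz] := triangle_not_in_line abc' q12.
rewrite -LE in Lz.
have cvL := triangular_convex tF FL.
have tL : triangle q1 q2 z `<=` L by exact: triangle_hull.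
have LU : L `<=` U by move=> x Lx; exists L.
have ctl : controlled p Omega U (triangle q1 q2 z).
  apply: (@controlled_exit R p hp Omega U mU _ (q1 - z)).
    by apply: measurable_plane_closed; exact: triangle_closed.
  move=> _ [s [t [u [s0 t0 u0 stu ->]]]].
  (* Moving along [q1 - z] transfers weight from [z] to [q1]. At time [u] the weight of [z] is used
     up and the point lies on the segment from [q1] to [q2], inside the boundary edge. *)
  have tri t' : 0 <= t' <= u ->
      triangle q1 q2 z (s *: q1 + t *: q2 + u *: z + t' *: (q1 - z)).
    move=> /andP[t'0 t'u]; exists (s + t'), t, (u - t'); split; [lra|lra|lra|lra|].
    by congr pair => /=; rewrite -![_ *: _]/(_ * _); ring.
  exists u; first by apply/andP; split; lra.
  split; last by move=> t' /tri/tL; exact: LU.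
  apply: boundary_open_notin => //.
  suff /Eb[] : segment a b (s *: q1 + t *: q2 + u *: z + u *: (q1 - z)) by [].
  apply: (segment_convex Eq1 Eq2); exists t; first by apply/andP; split; lra.
  have sE : s = 1 - t - u by lra.
  by congr pair => /=; rewrite -![_ *: _]/(_ * _) sE; ring.
have [x0 /nbhs_ballP[r /= r0 xr]] := triangle_interior_neq0 nz.
have ctl0 : controlled p Omega U (ball x0 r).
  apply: controlled_subset ctl => //; first exact: measurable_plane_ball.
  by apply: measurable_plane_closed; exact: triangle_closed.
have b0 : ball x0 r `<=` U°.
  by apply: ball_subset_interior; apply: subset_trans LU; exact: subset_trans tL.
have prop := controlled_region hp mU (@open_interior _ U) cS (@interior_subset _ U) r0 b0 ctl0.
(* Propagation reaches only interior points of the region. One controlled ball inside [K] is enough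
   to fill the closed triangle [K]. *)
have [x /nbhs_ballP[e /= e0 xe]] := triangular_interior_neq0 tF FK.
have Ux : U° x by apply: interiorS KU _ _; apply/nbhs_ballP; exists e.
have [e' [e'0 _ ce']] := prop _ Ux.
pose m := Num.min e e'.
have m0 : 0 < m by rewrite lt_min e0.
apply: (@controlled_fill R p hp Omega U mU K x m) => //.
- exact: triangular_convex FK.
- exact: triangular_compact FK.
- exact: triangular_closed FK.
- by apply: subset_trans xe; apply: le_ball; rewrite ge_min lexx.
- have := ce'; apply: controlled_subset => //; [exact: measurable_plane_ball..|].
  by apply: le_ball; rewrite ge_min lexx orbT.
Qed.

Lemma bigcup1_interior K : (\bigcup_(L in [set K]) L)° = K°.
Proof. by rewrite bigcup_set1. Qed.

(* [F] collects the elements of all flat regions containing [K°]. Since elements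
   lie in the closure of their interior, the interior of the union of [F] lies
   between the union of these regions and its closure, hence is connected. *)
Lemma maximal_flat_region_exists Omega T (v : plane R -> R) K :
  lipschitz_polygon Omega -> triangulation Omega T -> T K ->
  (forall x, K° x -> enorm (pw_grad T v x) = 0) ->
  exists F, [/\ F `<=` T, F K,
    forall L, F L -> forall x, L° x -> enorm (pw_grad T v x) = 0,
    connected (\bigcup_(L in F) L)° &
    maximal_flat_region Omega T v (\bigcup_(L in F) L)°].
Proof.
move=> [[_ oO _] _ _ lO] [fT tT _ TO] TK vK.
pose FF F := [/\ F `<=` T,
  forall L, F L -> forall x, L° x -> enorm (pw_grad T v x) = 0,
  connected (\bigcup_(L in F) L)° & K° `<=` (\bigcup_(L in F) L)°].
pose F := \bigcup_(F in FF) F.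
have FFK : FF [set K].
  split; rewrite ?bigcup1_interior//; [by move=> _ ->|by move=> _ ->|].
  apply: convex_connected; apply: interior_convex; exact: triangular_convex TK.
have FT : F `<=` T by move=> L [F' [F'T _ _ _]]; exact: F'T.
have FK : F K by exists [set K].
have Fv L : F L -> forall x, L° x -> enorm (pw_grad T v x) = 0.
  by move=> [F' [_ F'v _ _]]; exact: F'v.
have FFS F' : FF F' -> (\bigcup_(L in F') L)° `<=` (\bigcup_(L in F) L)°.
  by move=> hF'; apply: interiorS; apply: bigcup_subset => L F'L; exists F'.
have KS : K° `<=` (\bigcup_(L in F) L)°.
  by have [_ _ _ h] := FFK; apply: subset_trans h _; exact: FFS.
have [x0 Kx0] := triangular_interior_neq0 tT TK.
have cF : connected (\bigcup_(L in F) L)°.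
  pose A := \bigcup_(F' in FF) (\bigcup_(L in F') L)°.
  apply: (@connected_between _ A).
  - apply: bigcup_connected; first by exists x0 => F' [_ _ _]; exact.
    by move=> F' [].
  - by move=> x [F' hF']; exact: FFS.
  - move=> x /interior_subset[L [F' hF' F'L] Lx].
    have TL : T L by apply: FT; exists F'.
    have := convex_subset_closure_interior (triangular_convex tT TL)
      (triangular_interior_neq0 tT TL) Lx.
    apply: closureS => y Ly; exists F' => //; apply: interiorS Ly.
    by move=> z Lz; exists L.
exists F; split => //; split.
  split => //.
  - by exists x0; exact: KS.
  (* The elements are only known to lie in [closure Omega]; the Lipschitz boundary excludes slits,
     so interior points of the union are in [Omega]. *)
  - apply: subset_trans (lipschitz_interior_closure oO lO); apply: interiorS.
    by rewrite -TO; exact: bigcup_subset.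
  - by exists F.
(* A flat region containing this one contains [K°], so its family of elements is already a member of
   [FF]. *)
move=> S' [_ _ cS' [F' [F'T F'v] S'E]] SS'.
apply/seteqP; split => //; rewrite S'E; apply: FFS; split => //.
  by rewrite -S'E.
by rewrite -S'E; exact: subset_trans SS'.
Qed.

End flat_regions.

(** * Elementwise estimates *)

Section elements.
Context {R : realType} (p : R).
Hypothesis hp : 1 < p < 2.
Local Notation mu := (@leb2 R).
Implicit Types (x y d g : plane R) (K : set (plane R)) (f v : plane R -> R).
Variables (Omega : set (plane R)) (T : set (set (plane R))).

(** The support is compact, hence closed, so [f] vanishes in a neighbourhood of every point outside
    [Omega]. *)
Lemma test_function_admissible f : test_function Omega f -> admissible Omega f.
Proof.
move=> [sf [K [cK KO f0]]]; split; first exact: smooth_C1.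
  by move=> x nx; apply: f0 => /KO.
move=> x nx; have oK : open (~` K).
  by apply: closed_openC; apply: compact_closed => //; exact: norm_hausdorff.
have nK : (~` K) x by move=> /KO.
have fx : \forall y \near x, f y = cst (0 : R) y.
  by apply: filterS (open_nbhs_nbhs (conj oK nK)) => y /f0.
by rewrite /grad !(near_eq_derive _ fx) !derive_cst.
Qed.

Lemma derive_affine c g x d : 'D_d (fun y => c + dot g y) x = dot g d.
Proof.
rewrite /derive; apply: cvg_lim; first exact: Rhausdorff.
apply: cvg_near_cst; near=> h.
have h0 : h != 0 by near: h; exact: nbhs_dnbhs_neq.
rewrite /dot /= -![_ *: _]/(_ * _); field.
exact: h0.
Unshelve. all: by end_near.
Qed.

Lemma grad_affine v K c g x : K° x -> (forall y, K y -> v y = c + dot g y) ->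
  grad v x = g.
Proof.
move=> Kx vK; have vx : \forall y \near x, v y = (fun y => c + dot g y) y.
  by apply: filterS (Kx) => y /vK.
rewrite /grad !(near_eq_derive _ vx) !derive_affine /dot/=.
by case: g {vK vx} => g1 g2 /=; rewrite !mulr1 !mulr0 addr0 add0r.
Qed.

Lemma pw_grad_affine v K c g x : T K -> K° x ->
  (forall y, K y -> v y = c + dot g y) -> pw_grad T v x = g.
Proof.
move=> TK Kx vK; rewrite /pw_grad patchE mem_set; last by exists K.
exact: grad_affine vK.
Qed.

Lemma pw_grad_out v x : ~ (\bigcup_(K in T) K°) x -> pw_grad T v x = 0.
Proof. by move=> nx; rewrite /pw_grad patchE memNset. Qed.

(* Taken at an arbitrary interior point of [K]; [0] when there is none. *)
Definition slope v K : R :=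
  if pselect (exists x, K° x) is left e then enorm (pw_grad T v (projT1 (cid e)))
  else 0.

Lemma slope_ge0 v K : 0 <= slope v K.
Proof. by rewrite /slope; case: pselect. Qed.

Lemma slopeE v K x : S_h Omega T v -> T K -> K° x ->
  enorm (pw_grad T v x) = slope v K.
Proof.
move=> [_ aff _] TK Kx; have [c [g vK]] := aff _ TK.
rewrite /slope; case: pselect => [e|[]]; last by exists x.
by case: cid => y Ky /=; rewrite !(pw_grad_affine TK _ vK).
Qed.

Variable s : seq (set (plane R)).
Hypotheses (Ts : T = [set` s]) (tT : triangular T).

Let inT K : K \in s -> T K. Proof. by rewrite Ts. Qed.

Lemma measurable_enorm_pw_grad v : S_h Omega T v ->
  measurable_fun (setT : set (mplane R)) (fun x => enorm (pw_grad T v x)).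
Proof.
move=> vS; pose W := \bigcup_(K in T) K°.
have oW : open W by apply: bigcup_open => K _; exact: open_interior.
have mW : measurable (W : set (mplane R)) by exact: measurable_plane_open.
rewrite -(setUv W); apply/measurable_funU => //; first exact: measurableC.
split; last first.
  apply: (eq_measurable_fun (cst (0 : R))) => // x /set_mem nx.
  by rewrite pw_grad_out// enorm0.
suff h (r : seq (set (plane R))) : {subset r <= s} ->
    measurable (\bigcup_(K in [set` r]) K° : set (mplane R)) /\
    measurable_fun (\bigcup_(K in [set` r]) K° : set (mplane R))
      (fun x => enorm (pw_grad T v x)).
  by rewrite /W [X in \bigcup_(_ in X) _]Ts; have [] := h s (fun K Ks => Ks).
elim: r => [_|K r IH rs].
  by rewrite set_nil bigcup_set0; split=> //; exact: measurable_fun_set0.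
have [|mr mfr] := IH; first by move=> L Lr; apply: rs; rewrite inE Lr orbT.
have TK : T K by apply: inT; apply: rs; rewrite inE eqxx.
have -> : \bigcup_(L in [set` K :: r]) L° = K° `|` \bigcup_(L in [set` r]) L°.
  apply/seteqP; split => x.
    by move=> [j /=]; rewrite inE => /predU1P[->|js] jx; [left|right; exists j].
  move=> [ix|[j js jx]]; first by exists K => //=; rewrite inE eqxx.
  by exists j => //=; rewrite inE [j \in r]js orbT.
have mK := measurable_interior K.
split; first exact: measurableU.
apply/measurable_funU => //; split => //.
apply: (eq_measurable_fun (cst (slope v K))) => // x /set_mem Kx.
by rewrite (slopeE vS TK Kx).
Qed.

Definition skeleton := \bigcup_(K in T) (K `\` K°).

Lemma skeleton_negligible : mu.-negligible skeleton.
Proof.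
rewrite /skeleton Ts bigcup_seq; rewrite big_seq; apply: big_ind.
- exact: negligible_set0.
- by move=> A B; exact: negligibleU.
- move=> K /inT TK; have [a [b [c [abc KE]]]] := tT TK.
  exists (K `\` K°); split => //.
    by apply: measurableD; [exact: triangular_measurable TK|exact: measurable_interior].
  by rewrite KE; exact: leb2_triangle_boundary.
Qed.

Lemma measurable_skeleton : measurable (skeleton : set (mplane R)).
Proof.
rewrite /skeleton Ts bigcup_seq big_seq; apply: big_ind => [|A B|K /inT TK].
- exact: measurable0.
- exact: measurableU.
- by apply: measurableD; [exact: triangular_measurable TK|exact: measurable_interior].
Qed.

Lemma integral_skeleton (h : mplane R -> \bar R) : measurable_fun setT h ->
  (\int[mu]_(x in skeleton) h x = 0)%E.
Proof.
move=> mh; apply: null_set_integral; first exact: measurable_skeleton.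
  exact: measurable_funTS.
by apply/negligibleP; [exact: measurable_skeleton|exact: skeleton_negligible].
Qed.

(** [Omega] is covered by the open elements and the skeleton, which is a null set; subadditivity
    then suffices. *)
Lemma integral_le_elements (h : mplane R -> \bar R) : 
  measurable (Omega : set (mplane R)) ->
  Omega `<=` \bigcup_(K in T) K -> measurable_fun setT h -> (forall x, 0 <= h x)%E ->
  (\int[mu]_(x in Omega) h x <= \sum_(K <- s) \int[mu]_(x in K°) h x)%E.
Proof.
move=> mO OT mh h0.
have mW (r : seq (set (plane R))) : measurable (\big[setU/set0]_(K <- r) K° : set (mplane R)).
  by apply: big_ind => //; [exact: measurableU|move=> K _; exact: measurable_interior].
apply: (@le_trans _ _ (\int[mu]_(x in skeleton `|` \big[setU/set0]_(K <- s) K°) h x)%E).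
  apply: ge0_subset_integral => //.
  - by apply: measurableU => //; exact: measurable_skeleton.
  - exact: measurable_funTS.
  - move=> x /OT[K TK Kx]; have [Kix|nKx] := pselect (K° x); last by left; exists K.
    by right; rewrite -bigcup_seq; exists K => //; move: TK; rewrite Ts.
apply: (le_trans (ge0_integral_setU_le measurable_skeleton (mW _) mh h0)).
rewrite integral_skeleton// add0e; elim: (s) => [|K r IH].
  by rewrite !big_nil integral_set0.
rewrite !big_cons; apply: le_trans (ge0_integral_setU_le _ _ mh h0) _ => //.
  exact: measurable_interior.
by rewrite leeD2l.
Qed.

Variable v : plane R -> R.
Hypothesis vS : S_h Omega T v.
Hypothesis mO : measurable (Omega : set (mplane R)).

Local Notation kappa x := (enorm (pw_grad T v x)).

Lemma measurable_shifted_power_kappa (h : plane R -> R) (D : set (mplane R)) :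
  measurable_fun D h ->
  measurable_fun D (fun x => (shifted_power p (h x) (kappa x))%:E).
Proof.
move=> mh; apply/measurable_EFinP; apply: (@measurable_shifted_power R p _ (mplane R)) => //.
by apply: measurable_funTS; exact: measurable_enorm_pw_grad.
Qed.

Local Notation dirichlet f :=
  (\int[mu]_(x in Omega) (shifted_power p (enorm (grad f x)) (kappa x))%:E)%E.

Lemma dirichlet_ge0 f : (0 <= dirichlet f)%E.
Proof. by apply: integral_ge0 => x _; rewrite lee_fin. Qed.

(** Lowering the shift from [b] to the slope increases the modular, and outside [Omega] the gradient
    vanishes. It is used with [A] the whole plane and [b] a bound of all slopes, and with [A] a flat
    union and [b = 0]. *)
Lemma integral_grad_le_dirichlet f (A : set (mplane R)) (b : R) :
  admissible Omega f -> measurable A ->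
  (forall x, A x -> ~ skeleton x -> kappa x <= b) ->
  (\int[mu]_(x in A) (shifted_power p (enorm (grad f x)) b)%:E <= dirichlet f)%E.
Proof.
move=> [Cf _ g0] mA kb; have mS := measurable_skeleton.
have mh : measurable_fun setT
    (fun x : mplane R => (shifted_power p (enorm (grad f x)) b)%:E).
  exact: measurable_shifted_power_grad.
apply: (@le_trans _ _ (\int[mu]_(x in (A `\` skeleton) `|` skeleton)
    (shifted_power p (enorm (grad f x)) b)%:E)%E).
  apply: ge0_subset_integral => //.
  - by apply: measurableU => //; exact: measurableD.
  - exact: measurable_funTS.
  - by move=> x _; rewrite lee_fin.
  - by move=> x Ax; have [?|?] := pselect (skeleton x); [right|left].
apply: le_trans (ge0_integral_setU_le _ _ mh _) _ => //.
- exact: measurableD.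
- by move=> x; rewrite lee_fin.
rewrite integral_skeleton// adde0 [leLHS]integral_mkcond [leRHS]integral_mkcond.
have mG := measurable_enorm_grad Cf.
apply: ge0_le_integral => //.
- by move=> x _; apply: erestrict_ge0 => y _; rewrite lee_fin.
- apply/(measurable_restrictT _ _).1; first exact: measurableD.
  exact: measurable_funTS.
- apply/(measurable_restrictT _ _).1 => //.
  by apply: measurable_shifted_power_kappa; exact: measurable_funTS.
move=> x _; rewrite !patchE; case: ifPn => [/set_mem[Ax nx]|_]; last first.
  by case: ifP => // _; rewrite lee_fin.
case: ifPn => [_|]; first by rewrite lee_fin ler_shifted_powerr// kb.
by rewrite notin_setE => nO; rewrite g0// enorm0 shifted_power0.
Qed.

(** The sum replaces the maximum as an upper bound of the slopes, and its continuity in the slopes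
    is immediate. *)
Let M := \sum_(K <- s) slope v K.

Lemma slope_le_sum K : T K -> slope v K <= M.
Proof.
move=> TK; have Ks : K \in s by move: TK; rewrite Ts.
rewrite /M (perm_big _ (perm_to_rem Ks)) big_cons lerDl.
by apply: sumr_ge0 => L _; exact: slope_ge0.
Qed.

Lemma kappa_le x : kappa x <= M.
Proof.
have [[K TK Kx]|nx] := pselect ((\bigcup_(K in T) K°) x).
  by rewrite (slopeE vS TK Kx); exact: slope_le_sum.
by rewrite pw_grad_out// enorm0; apply: sumr_ge0 => K _; exact: slope_ge0.
Qed.

Variable D : R.
Hypotheses (D1 : 1 <= D) (exitD : forall x, Omega x -> ~ Omega (x + (D, 0))).

(** Every point of the plane reaches a zero of [f] along [(D, 0)]: points of [Omega] at time 1, all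
    others at time 0. *)
Lemma global_poincare f (A : set (mplane R)) (b : R) :
  admissible Omega f -> measurable A -> 0 <= b ->
  (\int[mu]_(x in A) (shifted_power p `|f x| b)%:E <=
   (D ^+ 2)%:E * \int[mu]_x (shifted_power p (enorm (grad f x)) b)%:E)%E.
Proof.
move=> [Cf f0 _] mA b0.
apply: (@integral_shifted_power_exit R p hp f A setT (D, 0) D b) => //=.
  by rewrite normr0 addr0 ger0_norm// (le_trans ler01 D1).
move=> x _; have [Ox|nx] := pselect (Omega x).
  exists 1; first by rewrite ler01 lexx.
  by rewrite scale1r; split => //; apply/f0/exitD.
exists 0; first by rewrite lexx ler01.
by rewrite scale0r addr0; split => //; exact: f0.
Qed.

Lemma steep_element_bound f K : admissible Omega f -> T K -> 0 < slope v K ->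
  (\int[mu]_(x in K°) (shifted_power p `|f x| (kappa x))%:E <=
   (M / slope v K * D ^+ 2)%:E * dirichlet f)%E.
Proof.
move=> af TK k0; have [Cf _ _] := af; have mK := measurable_interior K.
have M0 : 0 <= M by apply: le_trans (slope_le_sum TK); exact: slope_ge0.
have mf : measurable_fun (K° : set (mplane R)) (fun x => `|f x|).
  by apply: measurable_funTS; apply: measurableT_comp => //; exact: C1_measurable.
apply: (@le_trans _ _ (\int[mu]_(x in K°) ((M / slope v K)%:E * (shifted_power p `|f x| M)%:E))%E).
  apply: ge0_le_integral => //.
  - by move=> x _; rewrite lee_fin.
  - exact: measurable_shifted_power_kappa.
  - by apply: emeasurable_funM => //; exact: measurable_shifted_power_norm.
  - move=> x Kx; rewrite (slopeE vS TK Kx) -EFinM lee_fin.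
    by apply: shifted_power_shift_le => //; exact: slope_le_sum.
rewrite ge0_integralZl_EFin//; last 3 first.
- by move=> x _; rewrite lee_fin.
- exact: measurable_shifted_power_norm.
- by rewrite divr_ge0// ltW.
rewrite [X in (_ <= X * _)%E]EFinM -muleA lee_wpmul2l ?lee_fin ?divr_ge0 ?(ltW k0)//.
apply: (le_trans (global_poincare af mK M0)).
rewrite lee_wpmul2l ?lee_fin ?sqr_ge0//.
by apply: integral_grad_le_dirichlet => // x _ _; exact: kappa_le.
Qed.

(** On a flat union the slope is 0 off the skeleton, so the energy with shift 0 given by
    [controlled] is bounded by the actual one. *)
Lemma flat_element_bound F K : F `<=` T -> F K ->
  (forall L, F L -> forall x, L° x -> kappa x = 0) ->
  controlled p Omega (\bigcup_(L in F) L) K ->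
  exists2 C : R, 0 <= C & forall f, admissible Omega f ->
    (\int[mu]_(x in K°) (shifted_power p `|f x| (kappa x))%:E <=
     C%:E * dirichlet f)%E.
Proof.
move=> FT FK F0 [C C0 hC]; exists C => // f af; have [Cf _ _] := af.
have TK := FT _ FK; have mK := measurable_interior K.
have mU : measurable (\bigcup_(L in F) L : set (mplane R)).
  apply: measurable_plane_closed; apply: triangular_bigcup_closed.
    by apply: sub_finite_set FT _; apply/finite_seqP; exists s.
  by move=> L /FT; exact: tT.
have mf : measurable_fun setT (fun x : mplane R => `|f x|).
  by apply: measurableT_comp => //; exact: C1_measurable.
apply: (@le_trans _ _ (\int[mu]_(x in K) (shifted_power p `|f x| 0)%:E)%E).
  apply: (@le_trans _ _ (\int[mu]_(x in K°) (shifted_power p `|f x| 0)%:E)%E).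
    apply: ge0_le_integral => //.
    - by move=> x _; rewrite lee_fin.
    - by apply: measurable_shifted_power_kappa; exact: measurable_funTS.
    - exact: measurable_shifted_power_norm.
    - by move=> x _; rewrite lee_fin ler_shifted_powerr.
  apply: ge0_subset_integral => //.
  - exact: triangular_measurable TK.
  - exact: measurable_shifted_power_norm.
  - by move=> x _; rewrite lee_fin.
  - exact: interior_subset.
apply: (le_trans (hC f af)); rewrite lee_wpmul2l ?lee_fin//.
apply: integral_grad_le_dirichlet => // x [L FL Lx] nx.
have [Lix|nLx] := pselect (L° x); first by rewrite (F0 _ FL _ Lix).
by exfalso; apply: nx; exists L => //; exact: FT.
Qed.

End elements.

(** * Passage to the limit *)

Section passage_to_the_limit.
Context {R : realType} (p : R).
Hypothesis hp : 1 < p < 2.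
Local Notation mu := (@leb2 R).
Implicit Types (x : plane R) (f w : plane R -> R) (G : plane R -> plane R).
Variable Omega : set (plane R).
Hypothesis mO : measurable (Omega : set (mplane R)).

Lemma Lp_measurable f : Lp p Omega f ->
  measurable_fun (Omega : set (mplane R)) f.
Proof.
move=> /sub_Lfun_mfun; rewrite inE => mf.
exact/(measurable_restrictT _ _).2.
Qed.

Lemma integral_powR_Lp_norm f :
  (\int[mu]_(x in Omega) (`|f x| `^ p)%:E = poweR (Lp_norm p Omega f) p)%E.
Proof.
have p0 : p != 0 by case/andP: hp => *; rewrite gt_eqF//; lra.
rewrite /Lp_norm powR_Lnorm// [LHS]integral_mkcond; apply: eq_integral => x _.
by rewrite patchE /= patchE; case: ifP => //= _; rewrite normr0 powR0.
Qed.

Lemma cvg0_lt (u : nat -> \bar R) (e : R) : u n @[n --> \oo] --> 0%E -> 0 < e ->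
  \forall n \near \oo, (u n < e%:E)%E.
Proof.
move=> u0 e0; by apply: (u0 [set y | (y < e%:E)%E]); apply: open_ereal_lt'; rewrite lte_fin.
Qed.

(** Since [p > 1], a norm below 1 dominates its own [p]-th power, which avoids taking [p]-th roots
    of the tolerance. *)
Lemma poweR_le_self (y : \bar R) (e : R) : (0 <= y)%E -> (y < e%:E)%E -> e <= 1 ->
  (poweR y p <= e%:E)%E.
Proof.
case: y => [y| |]//; rewrite lee_fin lte_fin poweR_EFin lee_fin => y0 ye e1.
case/andP: (hp) => p1 p2; move: y0; rewrite le_eqVlt => /predU1P[yE|y0].
  by rewrite -yE in ye *; rewrite powR0; [exact: ltW|rewrite gt_eqF// (lt_trans ltr01)].
apply: (@le_trans _ _ y); last exact: ltW.
by apply: ge1r_powR; [rewrite y0/= ltW// (lt_le_trans ye)|exact: ltW].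
Qed.

Lemma W1p0_approx w G (e : R) : W1p0 p Omega w G -> 0 < e ->
  exists2 f, test_function Omega f &
    (\int[mu]_(x in Omega) (`|(f x - w x)%R| `^ p)%:E <= e%:E)%E /\
    (\int[mu]_(x in Omega) (enorm (grad f x - G x)%R `^ p)%:E <= e%:E)%E.
Proof.
move=> [_ [phi [tphi cw cG]]] e0.
pose d := Num.min e 1; have d0 : 0 < d by rewrite lt_min e0 ltr01.
have d1 : d <= 1 by rewrite ge_min lexx orbT.
have de : d <= e by rewrite ge_min lexx.
have [n [nw nG]] : exists n, (Lp_norm p Omega (fun x => (phi n x - w x)%R) < d%:E)%E /\
    (Lp_norm p Omega (fun x => enorm (grad (phi n) x - G x)%R) < d%:E)%E.
  have [N1 _ h1] := cvg0_lt cw d0; have [N2 _ h2] := cvg0_lt cG d0.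
  exists (maxn N1 N2); split; first exact: (h1 _ (leq_maxl _ _)).
  exact: (h2 _ (leq_maxr _ _)).
exists (phi n) => //; split; apply: (@le_trans _ _ d%:E); rewrite ?lee_fin//.
  rewrite integral_powR_Lp_norm; apply: poweR_le_self => //; exact: Lnorm_ge0.
have -> : (\int[mu]_(x in Omega) (enorm (grad (phi n) x - G x)%R `^ p)%:E =
    \int[mu]_(x in Omega) (`|enorm (grad (phi n) x - G x)%R| `^ p)%:E)%E.
  by apply: eq_integral => x _; rewrite ger0_norm.
rewrite (integral_powR_Lp_norm (fun x => enorm (grad (phi n) x - G x)%R)).
by apply: poweR_le_self => //; exact: Lnorm_ge0.
Qed.

Variable kappa : plane R -> R.
Hypothesis k0 : forall x, 0 <= kappa x.
Hypothesis mk : measurable_fun (Omega : set (mplane R)) kappa.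

(** The perturbation [b] is measured without shift, by its [p]-th power, because this is the
    quantity that convergence in [W1p] makes small. *)
Lemma integral_shifted_power_perturb (a b c : plane R -> R) :
  measurable_fun (Omega : set (mplane R)) a ->
  measurable_fun (Omega : set (mplane R)) b ->
  measurable_fun (Omega : set (mplane R)) c ->
  (forall x, 0 <= a x) -> (forall x, 0 <= b x) ->
  (forall x, 0 <= c x <= a x + b x) ->
  (\int[mu]_(x in Omega) (shifted_power p (c x) (kappa x))%:E <=
   4%:E * (\int[mu]_(x in Omega) (shifted_power p (a x) (kappa x))%:E +
           \int[mu]_(x in Omega) (b x `^ p)%:E))%E.
Proof.
move=> ma mb mc a0 b0 cab.
have mpsi (h : plane R -> R) : measurable_fun (Omega : set (mplane R)) h ->
    measurable_fun (Omega : set (mplane R)) (fun x => (shifted_power p (h x) (kappa x))%:E).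
  by move=> mh; apply/measurable_EFinP; exact: (@measurable_shifted_power R p _ (mplane R)).
have mbp : measurable_fun (Omega : set (mplane R)) (fun x => (b x `^ p)%:E).
  by apply/measurable_EFinP; apply: (measurableT_comp (measurable_powR _)).
rewrite -ge0_integralD//; last 3 first.
- by move=> x _; rewrite lee_fin.
- exact: mpsi.
- by move=> x _; rewrite lee_fin powR_ge0.
rewrite -ge0_integralZl_EFin//; last 2 first.
- by move=> x _; rewrite -EFinD lee_fin addr_ge0// powR_ge0.
- by apply: emeasurable_funD => //; exact: mpsi.
apply: ge0_le_integral => //.
- by move=> x _; rewrite lee_fin.
- exact: mpsi.
- by apply: emeasurable_funM => //; apply: emeasurable_funD => //; exact: mpsi.
move=> x _; rewrite -EFinD -EFinM lee_fin; have /andP[c0 cx] := cab x.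
apply: (@le_trans _ _ (shifted_power p (a x + b x) (kappa x))).
  exact: ler_shifted_powerl.
apply: (le_trans (shifted_powerD_le hp _ _ _)) => //.
by rewrite ler_wpM2l// lerD2l shifted_power_le_powR.
Qed.

Lemma approximable_inequality w G (C : R) : W1p0 p Omega w G -> 0 < C ->
  (forall f, admissible Omega f ->
    (\int[mu]_(x in Omega) (shifted_power p `|f x| (kappa x))%:E <=
     C%:E * \int[mu]_(x in Omega) (shifted_power p (enorm (grad f x)) (kappa x))%:E)%E) ->
  (\int[mu]_(x in Omega) (shifted_power p `|w x| (kappa x))%:E <=
   (16 * C)%:E * \int[mu]_(x in Omega) (shifted_power p (enorm (G x)) (kappa x))%:E)%E.
Proof.
move=> wG C0 hC; have [[/Lp_measurable mw /Lp_measurable mG1 /Lp_measurable mG2 _] _] := wG.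
apply/lee_addgt0Pr => e e0.
(* Approximating [w] costs [4 * d], and approximating its gradient costs [4 * C * 4 * d]. With
   [d = e / (16 * C + 4)] the total error is exactly [e]. *)
have c0 : 0 < 16 * C + 4 by lra.
have [f tf [fw fG]] := W1p0_approx wG (divr_gt0 e0 c0).
have af := test_function_admissible tf; have [Cf _ _] := af.
set d := e / (16 * C + 4) in fw fG.
have d0 : 0 <= d by rewrite divr_ge0// ltW.
have mf : measurable_fun (Omega : set (mplane R)) f.
  by apply: measurable_funTS; exact: C1_measurable.
have mgf : measurable_fun (Omega : set (mplane R)) (fun x => enorm (grad f x)).
  by apply: measurable_funTS; exact: measurable_enorm_grad.
have [mf1 mf2] : measurable_fun (Omega : set (mplane R)) (fun x => (grad f x).1) /\
    measurable_fun (Omega : set (mplane R)) (fun x => (grad f x).2).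
  case: Cf => _ cf; split; apply: measurable_funTS.
    exact: (continuous_plane_measurable (cf _)).
  exact: (continuous_plane_measurable (cf _)).
have mGn : measurable_fun (Omega : set (mplane R)) (fun x => enorm (G x)).
  exact: (@measurable_enorm R _ (mplane R)).
have mfG : measurable_fun (Omega : set (mplane R)) (fun x => enorm (grad f x - G x)%R).
  by apply: (@measurable_enorm R _ (mplane R)); exact: measurable_funB.
have h1 := @integral_shifted_power_perturb (fun x => `|f x|) (fun x => `|f x - w x|)
  (fun x => `|w x|).
have {}h1 : (\int[mu]_(x in Omega) (shifted_power p `|w x| (kappa x))%:E <=
   4%:E * (\int[mu]_(x in Omega) (shifted_power p `|f x| (kappa x))%:E +
           \int[mu]_(x in Omega) (`|(f x - w x)%R| `^ p)%:E))%E.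
  apply: h1 => //.
  - exact: measurableT_comp.
  - by apply: measurableT_comp => //; exact: measurable_funB.
  - exact: measurableT_comp.
  - by move=> x; rewrite normr_ge0/= -{1}[w x](subKr (f x)) ler_normB.
have h2 := @integral_shifted_power_perturb (fun x => enorm (G x))
  (fun x => enorm (grad f x - G x)%R) (fun x => enorm (grad f x)).
have {}h2 : (\int[mu]_(x in Omega) (shifted_power p (enorm (grad f x)) (kappa x))%:E <=
   4%:E * (\int[mu]_(x in Omega) (shifted_power p (enorm (G x)) (kappa x))%:E +
           \int[mu]_(x in Omega) (enorm (grad f x - G x)%R `^ p)%:E))%E.
  apply: h2 => //.
  move=> x; rewrite enorm_ge0/=; apply: le_trans (enormD _ _).
  by rewrite addrC subrK.
set I := (\int[mu]_(x in Omega) (shifted_power p `|w x| (kappa x))%:E)%E in h1 *.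
set J := (\int[mu]_(x in Omega) (shifted_power p (enorm (G x)) (kappa x))%:E)%E in h2 *.
have J0 : (0 <= J)%E by apply: integral_ge0 => x _; rewrite lee_fin.
have four0 : (0 <= 4%:E :> \bar R)%E by rewrite lee_fin.
have {}h2 := le_trans h2 (lee_wpmul2l four0 (leeD (le_refl J) fG)).
have {}h1 := le_trans h1 (lee_wpmul2l four0 (leeD (hC f af) fw)).
apply: (le_trans h1).
have C0' : (0 <= C%:E)%E by rewrite lee_fin ltW.
apply: (@le_trans _ _ (4%:E * (C%:E * (4%:E * (J + d%:E)) + d%:E))%E).
  by apply: lee_wpmul2l => //; rewrite leeD2r//; exact: lee_wpmul2l.
have [Jf|Jf] := boolP (J \is a fin_num).
  rewrite -(fineK Jf) -!(EFinD, EFinM) lee_fin.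
  rewrite le_eqVlt; apply/orP; left; apply/eqP.
  have -> : e = d * (16 * C + 4) by rewrite divfK// gt_eqF.
  by ring.
have -> : J = +oo%E by apply/eqP; move: Jf; rewrite ge0_fin_numE// -leNgt leye_eq.
by rewrite addye// !gt0_muley ?lte_fin ?mulr_gt0// !addye// leey//.
Qed.

End passage_to_the_limit.

(** * Dependence on the slopes *)

Section slopes_by_values.
Context {R : realType}.
Implicit Types (y : plane R) (v : plane R -> R) (K : set (plane R)).

(* The slope of [v] read off its values at [y], [y + (h, 0)] and [y + (0, h)]. *)
Definition secant_slope (yh : plane R * R) v : R :=
  enorm ((v (yh.1 + (yh.2, 0)) - v yh.1) / yh.2,
         (v (yh.1 + (0, yh.2)) - v yh.1) / yh.2).

Definition secant_base K (yh : plane R * R) : Prop :=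
  [/\ 0 < yh.2, K yh.1, K (yh.1 + (yh.2, 0)) & K (yh.1 + (0, yh.2))].

Lemma secant_base_exists K : open K -> K !=set0 -> exists yh, secant_base K yh.
Proof.
move=> oK [y Ky]; have /nbhs_ballP[r /= r0 yr] := open_nbhs_nbhs (conj oK Ky).
have r20 : 0 < r / 2 by rewrite divr_gt0.
have r2 : r / 2 < r by rewrite ltr_pdivrMr// ltr_pMr// ltr1n.
exists (y, r / 2); split => //=; apply: yr; apply/plane_ballP => /=.
  rewrite opprD addrA subrr sub0r normrN gtr0_norm//; split => //.
  by rewrite addr0 subrr normr0.
split; first by rewrite addr0 subrr normr0.
by rewrite opprD addrA subrr sub0r normrN gtr0_norm.
Qed.

(** Difference quotients of an affine function are exact. This expresses the slope by three point
    values of [v], which, unlike derivatives, depend continuously on [v] for uniform convergence. *)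
Lemma secant_slopeE Omega T v K yh : S_h Omega T v -> T K ->
  secant_base K° yh -> slope T v K = secant_slope yh v.
Proof.
move=> vS TK [h0 K1 K2 K3]; rewrite -(slopeE vS TK K1).
have [_ aff _] := vS; have [c [g vK]] := aff _ TK.
rewrite (pw_grad_affine TK K1 vK) /secant_slope.
rewrite !vK; do ?exact: interior_subset.
congr enorm; case: g {vK} => g1 g2; case: yh h0 K1 K2 K3 => [[y1 y2] h] /= h0 _ _ _.
by rewrite /dot/=; congr pair; field; rewrite gt_eqF.
Qed.

Lemma continuous_evaluation (Omega : set (plane R)) y : Omega y ->
  continuous (fun v : {uniform` Omega -> R} => v y).
Proof.
move=> Oy v A /nbhs_ballP[e /= e0 eA]; rewrite /nbhs/=.
apply/uniform_nbhs; exists [set ab : R * R | ball ab.1 e ab.2]; split.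
  exact: (entourage_ball _ (PosNum e0)).
by move=> w /= h; apply: eA; exact: h.
Qed.

Lemma continuous_enorm_quotient (X : topologicalType) (h : R) (e0 e1 e2 : X -> R) :
  continuous e0 -> continuous e1 -> continuous e2 ->
  continuous (fun z : X => enorm ((e1 z - e0 z) / h, (e2 z - e0 z) / h)).
Proof.
move=> c0 c1 c2 z.
have q1 : (fun z : X => (e1 z - e0 z) / h) @ z --> (e1 z - e0 z) / h.
  by apply: cvgM; [apply: cvgB; [exact: c1|exact: c0]|exact: cvg_cst].
have q2 : (fun z : X => (e2 z - e0 z) / h) @ z --> (e2 z - e0 z) / h.
  by apply: cvgM; [apply: cvgB; [exact: c2|exact: c0]|exact: cvg_cst].
apply: (@continuous_comp _ _ _ (fun z : X =>
   (e1 z - e0 z) / h * ((e1 z - e0 z) / h) + (e2 z - e0 z) / h * ((e2 z - e0 z) / h))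
   Num.sqrt).
  by apply: cvgD; apply: cvgM.
exact: sqrt_continuous.
Qed.

Lemma continuous_secant_slope (Omega : set (plane R)) yh : secant_base Omega yh ->
  continuous (fun v : {uniform` Omega -> R} => secant_slope yh v).
Proof.
move=> [_ O1 O2 O3].
exact: (@continuous_enorm_quotient {uniform` Omega -> R} yh.2 _ _ _
  (continuous_evaluation O1) (continuous_evaluation O2) (continuous_evaluation O3)).
Qed.

Lemma cvg_sum_seq (X : Type) (F : set_system X) (FF : Filter F) (I : eqType) (s : seq I)
    (u : I -> X -> R) (l : I -> R) : (forall i, i \in s -> u i @ F --> l i) ->
  (fun x => \sum_(i <- s) u i x) @ F --> \sum_(i <- s) l i.
Proof.
elim: s => [_|i s IH h].
  have -> : (fun x => \sum_(i <- [::]) u i x) = cst 0 by apply/funext => x; rewrite big_nil.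
  by rewrite big_nil; exact: cvg_cst.
have -> : (fun x => \sum_(j <- i :: s) u j x) = (fun x => u i x + \sum_(j <- s) u j x).
  by apply/funext => x; rewrite big_cons.
rewrite big_cons; apply: cvgD; first by apply: h; rewrite inE eqxx.
by apply: IH => j js; apply: h; rewrite inE js orbT.
Qed.

Lemma cvg_quotient_sum (X : topologicalType) (I : eqType) (s : seq I)
    (q : I -> X -> R) (c : R) (x : X) :
  (forall i, i \in s -> q i @ x --> q i x /\ q i x != 0) ->
  (fun z : X => 16 * (\sum_(i <- s) (\sum_(j <- s) q j z) / q i z * c + 1)) @ x -->
  16 * (\sum_(i <- s) (\sum_(j <- s) q j x) / q i x * c + 1).
Proof.
move=> hq; apply: cvgM; first exact: cvg_cst.
apply: cvgD; last exact: cvg_cst.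
apply: cvg_sum_seq => i /hq[qi qi0]; apply: cvgM; last exact: cvg_cst.
apply: cvgM; first by apply: cvg_sum_seq => j /hq[].
exact: cvgV.
Qed.

End slopes_by_values.

(** * Assembly of the constants *)

Section poincare_friedrichs.
Context {R : realType} (p : R) (Omega : set (plane R)) (T : set (set (plane R))).
Hypotheses (hp : 1 < p < 2) (hOmega : lipschitz_polygon Omega)
  (hT : triangulation Omega T).

Let mO : measurable (Omega : set (mplane R)).
Proof. by case: hOmega => [[_ oO _] _ _ _]; exact: measurable_plane_open. Qed.

Let tT : triangular T. Proof. by case: hT. Qed.

Let OT : Omega `<=` \bigcup_(K in T) K.
Proof. by case: hT => _ _ _ ->; exact: subset_closure. Qed.

Lemma exit_distance : exists2 D : R, 1 <= D &
  forall x, Omega x -> ~ Omega (x + (D, 0)).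
Proof.
case: hOmega => _ [M [_ hM]] _ _.
have {}hM x : Omega x -> `|x.1| <= `|M| + 1.
  move=> Ox; apply: (@le_trans _ _ `|x|); first by rewrite prod_normE le_max lexx.
  by apply: (hM (`|M| + 1)) => //; rewrite (le_lt_trans (ler_norm M))// ltrDl.
have M0 := normr_ge0 M.
(* First coordinates of points of [Omega] lie in an interval of length [2 * |M| + 2]. *)
exists (2 * `|M| + 3); first by lra.
move=> x /hM; rewrite ler_norml => /andP[h1 h2] /hM; rewrite ler_norml /=.
by move=> /andP[h3 h4]; lra.
Qed.

Lemma element_interior_subset K : T K -> K° `<=` Omega.
Proof.
case: hOmega => [[_ oO _] _ _ lO] TK.
apply: subset_trans (lipschitz_interior_closure oO lO); apply: interiorS.
by case: hT => _ _ _ <- x Kx; exists K.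
Qed.

(** Sums the elementwise bounds and then passes to the limit, which contributes 16. The added 1
    keeps the constant positive even if all [c K] are 0. *)
Lemma PF_inequality_of_elements v (s : seq (set (plane R))) (c : set (plane R) -> R) :
  T = [set` s] -> S_h Omega T v ->
  (forall K, T K -> 0 <= c K /\ forall f, admissible Omega f ->
    (\int[@leb2 R]_(x in K°) (shifted_power p `|f x| (enorm (pw_grad T v x)))%:E <=
     (c K)%:E * \int[@leb2 R]_(x in Omega)
       (shifted_power p (enorm (grad f x)) (enorm (pw_grad T v x)))%:E)%E) ->
  0 < 16 * (\sum_(K <- s) c K + 1) /\
  PF_inequality p Omega T v (16 * (\sum_(K <- s) c K + 1)).
Proof.
move=> Ts vS hc; have inT K : K \in s -> T K by rewrite Ts.
have S0 : 0 <= \sum_(K <- s) c K.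
  by rewrite big_seq; apply: sumr_ge0 => K /inT /hc[].
split; first by lra.
move=> w G wG; apply: (approximable_inequality hp mO _ _ wG) => //.
- by apply: measurable_funTS; exact: (measurable_enorm_pw_grad Ts vS).
- by lra.
move=> f af; have [Cf _ _] := af.
have mh : measurable_fun setT (fun x : mplane R =>
    (shifted_power p `|f x| (enorm (pw_grad T v x)))%:E).
  apply: (measurable_shifted_power_kappa p Ts vS).
  by apply: measurableT_comp => //; exact: C1_measurable.
apply: (le_trans (integral_le_elements Ts tT mO OT mh _)).
  by move=> x; rewrite lee_fin.
set J := (X in (_ <= _ * X)%E).
have J0 : (0 <= J)%E by exact: dirichlet_ge0.
apply: (@le_trans _ _ ((\sum_(K <- s) c K)%:E * J)%E); last first.
  by rewrite lee_wpmul2r// lee_fin lerDl.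
have : {subset s <= T} by move=> K /inT/mem_set.
elim: (s) => [_|K r IH sT].
  by rewrite !big_nil mul0e.
have TK : T K by apply/set_mem/sT; rewrite inE eqxx.
have rT : {subset r <= T} by move=> L Lr; apply: sT; rewrite inE Lr orbT.
have [c0 cK] := hc _ TK.
rewrite !big_cons EFinD ge0_muleDl ?lee_fin//; last first.
  by rewrite big_seq; apply: sumr_ge0 => L /rT/set_mem/hc[].
by apply: leeD; [exact: cK|exact: IH].
Qed.

Lemma steep_constant (s : seq (set (plane R))) v K (D : R) : T = [set` s] ->
  S_h Omega T v -> 1 <= D -> (forall x, Omega x -> ~ Omega (x + (D, 0))) ->
  T K -> 0 < slope T v K ->
  0 <= (\sum_(L <- s) slope T v L) / slope T v K * D ^+ 2 /\
  forall f, admissible Omega f ->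
    (\int[@leb2 R]_(x in K°) (shifted_power p `|f x| (enorm (pw_grad T v x)))%:E <=
     ((\sum_(L <- s) slope T v L) / slope T v K * D ^+ 2)%:E *
     \int[@leb2 R]_(x in Omega)
       (shifted_power p (enorm (grad f x)) (enorm (pw_grad T v x)))%:E)%E.
Proof.
move=> Ts vS D1 exitD TK k0; split.
  apply: mulr_ge0; last exact: sqr_ge0.
  apply: divr_ge0; last exact: ltW.
  by apply: sumr_ge0 => L _; exact: slope_ge0.
by move=> f af; apply: steep_element_bound.
Qed.

Lemma PF_inequality_exists v : S_h Omega T v -> flat_regions_reach_boundary Omega T v ->
  exists C : R, 0 < C /\ PF_inequality p Omega T v C.
Proof.
move=> vS flat; have [fT _ _ _] := hT; have [s Ts] := (finite_seqP T).1 fT.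
have [D D1 exitD] := exit_distance.
have : forall K, exists c : R, T K -> 0 <= c /\ forall f, admissible Omega f ->
    (\int[@leb2 R]_(x in K°) (shifted_power p `|f x| (enorm (pw_grad T v x)))%:E <=
     c%:E * \int[@leb2 R]_(x in Omega)
       (shifted_power p (enorm (grad f x)) (enorm (pw_grad T v x)))%:E)%E.
  move=> K; have [TK|nK] := pselect (T K); last by exists 0.
  have [k0|k0] := ltP 0 (slope T v K).
    by exists ((\sum_(L <- s) slope T v L) / slope T v K * D ^+ 2) => _; exact: steep_constant.
  have K0 x : K° x -> enorm (pw_grad T v x) = 0.
    by move=> Kx; apply/eqP; rewrite (slopeE vS TK Kx) eq_le k0 slope_ge0.
  have [F [FT FK Fv cF mF]] := maximal_flat_region_exists hOmega hT TK K0.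
  have [K1 [E [TK1 eE Eb]]] := flat _ mF.
  have [[_ oO _] _ _ _] := hOmega.
  have cK := flat_region_controlled hp oO fT tT FT cF TK1 eE Eb FK.
  by have [c c0 hc] := flat_element_bound hp Ts tT vS mO FT FK Fv cK; exists c.
move/choice => [c hc]; exists (16 * (\sum_(K <- s) c K + 1)).
exact: PF_inequality_of_elements.
Qed.

Lemma grad_nonvanishing_slope_gt0 v K : S_h Omega T v -> grad_nonvanishing T v ->
  T K -> 0 < slope T v K.
Proof.
move=> vS nv TK; have [x Kx] := triangular_interior_neq0 tT TK.
by rewrite -(slopeE vS TK Kx) lt_neqAle eq_sym (nv _ TK _ Kx)/=.
Qed.

(** The bound is itself a valid constant. Continuity refers to uniform convergence on [Omega], which
    induces the usual topology of the finite-dimensional space [S_h]. *)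
Lemma steep_PF_constant_continuous :
  exists Cbar : {uniform` Omega -> R} -> R,
    {within [set v : {uniform` Omega -> R} | S_h Omega T v /\ grad_nonvanishing T v],
       continuous Cbar} /\
    forall v, S_h Omega T v -> grad_nonvanishing T v ->
      0 < Cbar v /\ PF_inequality p Omega T v (Cbar v).
Proof.
have [fT _ _ _] := hT; have [s Ts] := (finite_seqP T).1 fT.
have [D D1 exitD] := exit_distance.
have inT K : K \in s -> T K by rewrite Ts.
have : forall K, exists yh, T K -> secant_base K° yh.
  move=> K; have [TK|nK] := pselect (T K); last by exists (0, 0).
  have [yh h] := secant_base_exists (@open_interior _ K) (triangular_interior_neq0 tT TK).
  by exists yh.
move/choice => [yh hyh].
have secant v K : S_h Omega T v -> T K -> secant_slope (yh K) v = slope T v K.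
  by move=> vS TK; rewrite (secant_slopeE vS TK (hyh _ TK)).
pose q K (v : {uniform` Omega -> R}) := secant_slope (yh K) v.
(* The constant of [steep_constant] with secant slopes in place of slopes. It is defined for every
   function, and on [S_h] the two agree. *)
exists (fun v => 16 * (\sum_(K <- s) (\sum_(L <- s) q L v) / q K v * D ^+ 2 + 1)).
split.
  apply: continuous_in_subspaceT => v /set_mem[vS nv].
  apply: (@cvg_quotient_sum R {uniform` Omega -> R} _ s q (D ^+ 2) v) => K /inT TK.
  split; last by rewrite /q secant// gt_eqF// grad_nonvanishing_slope_gt0.
  apply: continuous_secant_slope; have [h0 K1 K2 K3] := hyh _ TK.
  by split => //; apply: (element_interior_subset TK).
move=> v vS nv.
have -> : \sum_(K <- s) (\sum_(L <- s) q L v) / q K v * D ^+ 2 =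
    \sum_(K <- s) (\sum_(L <- s) slope T v L) / slope T v K * D ^+ 2.
  rewrite big_seq [RHS]big_seq; apply: eq_bigr => K /inT TK.
  rewrite /q secant//; congr (_ / _ * _).
  by rewrite big_seq [RHS]big_seq; apply: eq_bigr => L /inT TL; rewrite secant.
apply: PF_inequality_of_elements => // K TK.
by apply: steep_constant => //; exact: grad_nonvanishing_slope_gt0.
Qed.

End poincare_friedrichs.

Theorem lemma3p5 (R : realType) (Omega : set (plane R)) (T : set (set (plane R)))
    (rho p : R) (hOmega : lipschitz_polygon Omega) (hT : triangulation Omega T)
    (hrho : quasi_uniform rho T) (hp : 1 < p < 2) :
  exists C : (plane R -> R) -> R,
    (forall v, S_h Omega T v -> flat_regions_reach_boundary Omega T v ->
       0 < C v /\ PF_inequality p Omega T v (C v)) /\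
    (exists Cbar : {uniform` Omega -> R} -> R,
       {within [set v : {uniform` Omega -> R} | S_h Omega T v /\ grad_nonvanishing T v],
          continuous Cbar} /\
       forall v, S_h Omega T v -> grad_nonvanishing T v -> C v <= Cbar v).
Proof.
have [Cbar [cC hC]] := steep_PF_constant_continuous hp hOmega hT.
(* Where no slope vanishes, [C v] is chosen to be [Cbar v], so the upper bound is an equality. For
   the other functions in question any constant will do, and 0 serves as a default elsewhere. *)
pose P v (c : R) := [/\ S_h Omega T v -> flat_regions_reach_boundary Omega T v ->
    0 < c /\ PF_inequality p Omega T v c &
  S_h Omega T v -> grad_nonvanishing T v -> c <= Cbar v].
have : forall v, exists c, P v c.
  move=> v; have [[vS nv]|h] := pselect (S_h Omega T v /\ grad_nonvanishing T v).
    by exists (Cbar v); split => // _ _; exact: hC.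
  have [[vS fv]|h'] := pselect (S_h Omega T v /\ flat_regions_reach_boundary Omega T v).
    have [c hc] := PF_inequality_exists hp hOmega hT vS fv.
    by exists c; split => // vS' nv; exfalso; apply: h.
  by exists 0; split => vS hv; exfalso; [apply: h'|apply: h].
move/choice => [C hPC]; exists C; split; first by move=> v; have [] := hPC v.
by exists Cbar; split => // v; have [] := hPC v.
Qed.
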